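(* Let $\alpha\in[0,1]$ and $h\le 1$, and let $U_{\alpha,h}$ be the capped power utility. For a collection $H$ of probability measures and a probability measure $Q$ on a measurable space $\mathcal{X}$, with generalized Lebesgue decomposition $Q=Q_a+Q_s$ with respect to $H$, and for $\varepsilon_0\in\mathcal{E}(H)$ and $0<h\le 1$, define $$C_h(\varepsilon_0):=\left\{\varepsilon\in\mathcal{E}(H): \mathrm{E}^{Q_a}[\varepsilon^h-\varepsilon_0^h]\ge 0\right\}.$$ 1. If $\alpha>0$ or $h\le 0$, then a $U_{\alpha,h}$-optimal e-value exists for every pair $(H,Q)$ and can be chosen to take values in $[0,1/\alpha]$. 2. If $\alpha=0$ and $0<h<1$, then a $U_{0,h}$-optimal e-value exists if $$\sup_{\varepsilon\in C_h(\varepsilon_0)}\mathrm{E}^{Q_a}[\varepsilon]<\infty$$ for some $\varepsilon_0\in\mathcal{E}(H)$ with $\mathrm{E}^{Q_a}[\varepsilon_0^h]<\infty$. 3. If $\alpha=0$ and $h=1$, then a $U_{0,1}$-optimal e-value exists if $C_1(\varepsilon_0)$ is uniformly $Q_a$-integrable for some $\varepsilon_0\in\mathcal{E}(H)$ with $\mathrm{E}^{Q_a}[\varepsilon_0]<\infty$.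
   Context: Conventions: $1/0=\infty$, $0^r=\infty$ for $r<0$. $\mathrm{E}^\mu[f]=\int f\,d\mu$ for any nonnegative measure $\mu$. Power utility: $U_h(z)=(z^h-1)/h$ for $h\ne 0$ and $U_0(z)=\log(z)$, $z\in[0,\infty]$ (extended-real values by the usual limits at $0$ and $\infty$). Capped power utility: $U_{\alpha,h}(z)=U_h(\min(z,1/\alpha))$ for $\alpha\in[0,1]$. An event is $H$-negligible if it has probability zero under every $P\in H$. The generalized Lebesgue decomposition of $Q$ with respect to $H$ is $Q=Q_a+Q_s$, where the nonnegative measure $Q_s$ is concentrated on an $H$-negligible event and the nonnegative measure $Q_a$ assigns zero mass to every $H$-negligible event. The class of valid e-values for $H$ is $\mathcal{E}(H)=\{\varepsilon:\mathcal{X}\to[0,\infty]\ \text{measurable}: \mathrm{E}^P[\varepsilon]\le 1\ \text{for all } P\in H\}$. For measurable $U:[0,\infty]\to[-\infty,\infty]$, a valid e-value $\varepsilon^*\in\mathcal{E}(H)$ is $U$-optimal (against $Q_a$) if, for every $\varepsilon\in\mathcal{E}(H)$, $\mathrm{E}^{Q_a}[U(\varepsilon^* )-U(\varepsilon)]$ is well-defined and $\ge 0$. Here ''well-defined'' means that the integrand avoids an ambiguous $\infty-\infty$ $Q_a$-almost surely, and that its positive part or its negative part has finite $Q_a$-expectation. *)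

(* Defs.v *)
From HB Require Import structures.
From mathcomp Require Import all_boot all_order all_algebra.
From mathcomp Require Import all_classical all_reals all_analysis.
From mathcomp Require Import measurable_realfun.
Set Implicit Arguments.
Unset Strict Implicit.
Unset Printing Implicit Defensive.
Import Order.TTheory GRing.Theory Num.Theory.
Local Open Scope classical_set_scope.
Local Open Scope ring_scope.
Local Open Scope ereal_scope.

(* [z ^ h] for [z] in [[0, +oo]].  The library's [poweR] gives [0 `^ h = 0] and
   [+oo `^ h = +oo] also when [h < 0]; there we use the inverse on [\bar R]
   ([0^-1 = +oo], [+oo^-1 = 0]), so that [0 ^ h = +oo] and [+oo ^ h = 0]. *)
Definition epow {R : realType} (h : R) (z : \bar R) : \bar R :=
  if (h < 0)%R then (poweR z (- h))^-1 else poweR z h.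

Definition power_utility {R : realType} (h : R) (z : \bar R) : \bar R :=
  if h == 0%R then lne z else (epow h z - 1) * (h^-1)%:E.

(* [a%:E^-1] is [+oo] for [a = 0], i.e. there is then no capping. *)
Definition capped_power_utility {R : realType} (a h : R) (z : \bar R) :
    \bar R :=
  power_utility h (Order.min z (a%:E)^-1).

Definition null_event {R : realType} {d : measure_display}
    {X : measurableType d} (H : set (probability X R)) (N : set X) : Prop :=
  measurable N /\ forall P : probability X R, H P -> P N = 0.

Definition generalized_lebesgue_decomposition {R : realType}
    {d : measure_display} {X : measurableType d} (H : set (probability X R))
    (Q : probability X R) (Qa Qs : {measure set X -> \bar R}) : Prop :=
  [/\ forall A : set X, measurable A -> Q A = Qa A + Qs A,
      exists2 N : set X, null_event H N & Qs (~` N) = 0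
    & forall N : set X, null_event H N -> Qa N = 0].

Definition evalues {R : realType} {d : measure_display} {X : measurableType d}
    (H : set (probability X R)) : set (X -> \bar R) :=
  [set e : X -> \bar R | [/\ measurable_fun [set: X] e, forall x, 0 <= e x
             & forall P : probability X R, H P -> \int[P]_x e x <= 1]].

(* The expectation of [f - g] is well-defined and nonnegative.  On [\bar R]
   subtraction is total, hence the explicit condition [f x +? - g x] excluding
   [oo - oo]; the last integral is by definition the difference of the
   integrals of the positive and negative parts. *)
Definition expectation_sub_ge0 {R : realType} {d : measure_display}
    {X : measurableType d} (mu : {measure set X -> \bar R})
    (f g : X -> \bar R) : Prop :=
  [/\ {ae mu, forall x, f x +? - g x},
      \int[mu]_x ((fun y => f y - g y)^\+ x) < +oo \/
      \int[mu]_x ((fun y => f y - g y)^\- x) < +oo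
    & 0 <= \int[mu]_x (f x - g x)].

(* Utilities are only evaluated on [[0, +oo]], where e-values live. *)
Definition U_optimal {R : realType} {d : measure_display}
    {X : measurableType d} (H : set (probability X R))
    (Qa : {measure set X -> \bar R}) (U : \bar R -> \bar R)
    (e : X -> \bar R) : Prop :=
  evalues H e /\
  forall e' : X -> \bar R, evalues H e' ->
    expectation_sub_ge0 Qa (U \o e) (U \o e').

Definition power_improvements {R : realType} {d : measure_display}
    {X : measurableType d} (H : set (probability X R))
    (Qa : {measure set X -> \bar R}) (h : R) (e0 : X -> \bar R) :
    set (X -> \bar R) :=
  [set e : X -> \bar R |
    evalues H e /\ expectation_sub_ge0 Qa (epow h \o e) (epow h \o e0)].

Definition uniformly_integrable {R : realType} {d : measure_display}
    {X : measurableType d} (mu : {measure set X -> \bar R})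
    (F : set (X -> \bar R)) : Prop :=
  forall eta : R, (0 < eta)%R -> exists K : R, forall f : X -> \bar R, F f ->
    \int[mu]_(x in [set x | K%:E <= `|f x|]) `|f x| <= eta%:E.

(* Main.v *)
Require Import Defs.
From HB Require Import structures.
From mathcomp Require Import all_boot all_order all_algebra.
From mathcomp Require Import all_classical all_reals all_analysis.
From mathcomp Require Import measurable_realfun.
From mathcomp Require Import ring lra.
Import Order.TTheory GRing.Theory Num.Theory.
Import numFieldNormedType.Exports.
Local Open Scope classical_set_scope.
Local Open Scope ring_scope.
Local Open Scope ereal_scope.

(** Every e-value is finite outside an event that is null under all of [H],
    hence [Qa]-almost everywhere, so the whole problem can be posed for
    real-valued e-values. These form a convex set, with no compactness in a
    usual topology to rely on, as [H] need not be dominated; the substitute is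
    [countable_compactness]: countably many convex sets of e-values that are
    closed under [Qa]-almost everywhere limits have a common point as soon as
    finitely many of them always do. The proof takes near-minimizers of the
    strictly convex functional [f |-> \int 1 / (1 + f)]: strict convexity turns
    near-minimality into almost everywhere convergence, and Fatou's lemma under
    each [P] in [H] shows that the limit is an e-value.

    The convex closed sets to which this is applied are sublevel sets of
    [f |-> \int w * V(f)], where [V] is nonnegative, nonincreasing, convex and
    lower semicontinuous (a [loss]); see [sublevel_convex_closed]. Three
    choices settle all the cases.

    - If the utility is bounded above ([a > 0] or [h < 0]), the shortfall
      [V = U(+oo) - U] is a loss. A minimizer of its integral lies in the
      intersection of the sublevel sets whose levels decrease to the infimum.

    - If [a = h = 0], the expected utility may be infinite, so it cannot be
      maximized directly. Instead, the log-optimal e-value [f_n] with cap [n],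
      given by the previous case, satisfies the first-order condition
      [\int g / f_n <= Qa(X)] for every e-value [g <= n]. This condition is
      preserved in the limit since [y |-> 1 / y] is a loss, and yields the
      numeraire property [\int g / f <= Qa(X)] for all e-values [g]. Since
      [log r <= r - 1], a numeraire is log-optimal, whatever the value of
      [\int log f].

    - If [a = 0] and [0 < h], the integral of [f^h] is bounded above and its
      tails are uniformly small on the e-values that improve on [e0], by either
      of the two hypotheses. Hence [\int f^h >= S], with [S] the supremum, is
      equivalent to countably many lower bounds on [\int min(f, K)^h], and each
      of these is an upper bound on the integral of a shortfall. *)

(** * Power utilities lie below their tangents *)

(** This is concavity of the logarithm at [r] and [1] with weights [h] and
    [1 - h], proved by bounding both logarithms by the tangent at the
    barycenter [m]. *)
Lemma bernoulli_powR (R : realType) (h r : R) : (0 < h <= 1)%R -> (0 <= r)%R ->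
  (r `^ h <= 1 + h * (r - 1))%R.
Proof.
move=> /andP[h0 h1] r0.
have [->|rn0] := eqVneq r 0%R; first by rewrite powR0 ?gt_eqF//; lra.
have {rn0}r0 : (0 < r)%R by rewrite lt0r rn0.
set m := (1 + h * (r - 1))%R.
have m0 : (0 < m)%R by rewrite /m; nra.
rewrite /powR gt_eqF// -[leRHS]lnK ?posrE// ler_expR.
have le1 (x : R) : (0 < x)%R -> (ln x <= x - 1)%R.
  by move=> x0; have := @le_ln1Dx R (x - 1)%R; rewrite addrCA subrr addr0;
    apply; lra.
have := le1 (r / m)%R (divr_gt0 r0 m0); rewrite ln_div ?posrE// => H1.
have := le1 (1 / m)%R (divr_gt0 ltr01 m0); rewrite ln_div ?posrE// ln1 => H2.
have : (h * (r / m - 1) + (1 - h) * (1 / m - 1) = 0)%R.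
  by rewrite /m; field; rewrite -/m gt_eqF.
have h1' : (0 <= 1 - h)%R by lra.
have := ler_wpM2l (ltW h0) H1; have := ler_wpM2l h1' H2; lra.
Qed.

Lemma bernoulli_powR_neg (R : realType) (h r : R) : (h <= 0)%R -> (0 < r)%R ->
  (1 + h * (r - 1) <= r `^ h)%R.
Proof.
move=> h0 r0; rewrite /powR gt_eqF//.
apply: le_trans (expR_ge1Dx _).
have := @le_ln1Dx R (r - 1)%R; rewrite addrCA subrr addr0 => H.
rewrite lerD2l; nra.
Qed.

(** [power_utility] where its value is finite. *)
Definition real_utility {R : realType} (h y : R) : R :=
  if h == 0%R then ln y else ((y `^ h - 1) / h)%R.

(** Concavity in tangent form. Scaling by [m] reduces it to the Bernoulli
    inequality for the ratio [y / m]. Both the concavity and the monotonicity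
    of the utilities are read off from this one estimate. *)
Lemma real_utility_tangent (R : realType) (h m y : R) : (h <= 1)%R ->
  (0 < m)%R -> (0 <= y)%R -> (0 < y)%R \/ (0 < h)%R ->
  (real_utility h y <= real_utility h m + m `^ (h - 1) * (y - m))%R.
Proof.
move=> h1 m0 y0 yh; rewrite /real_utility; case: eqVneq => [h0|hn0].
  case: yh => [{}y0|]; last by rewrite h0 ltxx.
  have := @le_ln1Dx R (y / m - 1)%R; rewrite addrCA subrr addr0 ln_div ?posrE//
    => H.
  rewrite h0 sub0r powR_inv1 ?(ltW m0)//.
  have {}H : (ln y - ln m <= y / m - 1)%R.
    by apply: H; have := divr_gt0 y0 m0; lra.
  have -> : (m^-1 * (y - m) = y / m - 1)%R by field; rewrite gt_eqF.
  lra.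
have -> : (m `^ (h - 1) * (y - m) = m `^ h * (y / m - 1))%R.
  rewrite powRB ?(gt_eqF m0) ?implybT// powRr1 ?(ltW m0)//; field;
    rewrite gt_eqF//.
set r := (y / m)%R.
have r0 : (0 <= r)%R by rewrite divr_ge0// ltW.
have -> : (y `^ h = r `^ h * m `^ h)%R.
  by rewrite -powRM ?(ltW m0)// /r divfK// gt_eqF.
have mh : (0 < m `^ h)%R by rewrite powR_gt0.
have key : ((r `^ h - 1) / h <= r - 1)%R.
  case: (ltgtP h 0%R) hn0 => // h0 _.
    have rp : (0 < r)%R by case: yh => [?|]; [exact: divr_gt0|lra].
    rewrite ler_ndivrMr//; have := @bernoulli_powR_neg R h r (ltW h0) rp; lra.
  rewrite ler_pdivrMr//; have := @bernoulli_powR R h r;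
    rewrite h0 h1 => /(_ isT r0); lra.
have := ler_wpM2l (ltW mh) key.
have -> : (m `^ h * ((r `^ h - 1) / h) =
  (r `^ h * m `^ h - 1) / h - (m `^ h - 1) / h)%R by field.
lra.
Qed.

Lemma power_utilityE (R : realType) (h y : R) : (0 <= y)%R ->
  (0 < y)%R \/ (0 < h)%R -> power_utility h y%:E = (real_utility h y)%:E.
Proof.
move=> y0 yh; rewrite /power_utility /real_utility; case: eqVneq => [h0|hn0].
  by case: yh => [?|]; [rewrite lne_EFin|rewrite h0 ltxx].
rewrite /epow; case: ifPn => [hlt|hge].
  case: yh => [yp|]; last by rewrite ltNge ltW.
  by rewrite poweR_EFin inver gt_eqF ?powR_gt0// powRN invrK.
by rewrite poweR_EFin.
Qed.

Lemma power_utility0 (R : realType) (h : R) : (h <= 0)%R ->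
  power_utility h 0 = -oo.
Proof.
move=> h0; rewrite /power_utility; case: eqVneq => [_|hn0].
  by rewrite le0_lneNy.
have hlt : (h < 0)%R by rewrite lt_neqAle hn0.
rewrite /epow hlt poweR_EFin powR0 ?oppr_eq0// inve0.
by rewrite addye// lt0_mulye ?lte_fin ?invr_lt0.
Qed.

(** The real counterpart of the minimum with [1 / a] in [capped_power_utility],
    with no cap when [a = 0]. *)
Definition cap {R : realType} (a y : R) : R :=
  if a == 0%R then y else Num.min y a^-1%R.

Section utility.
Context {R : realType}.
Implicit Types (a h m t x y : R).

Lemma capped_power_utilityE a h y :
  capped_power_utility a h y%:E = power_utility h (cap a y)%:E.
Proof.
rewrite /capped_power_utility /cap inver; case: ifP => _;
  last by rewrite EFin_min.
by rewrite min_l// leey.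
Qed.

Lemma cap_gt0 a y : (0 <= a)%R -> (0 < y)%R -> (0 < cap a y)%R.
Proof.
rewrite /cap; case: eqVneq => // an0 a0 y0.
by rewrite lt_min y0 invr_gt0 lt0r an0.
Qed.

Lemma cap_ge0 a y : (0 <= a)%R -> (0 <= y)%R -> (0 <= cap a y)%R.
Proof.
by rewrite /cap; case: eqVneq => // an0 a0 y0; rewrite le_min y0 invr_ge0.
Qed.

Lemma cap_le a y : (cap a y <= y)%R.
Proof. by rewrite /cap; case: eqVneq => // _; rewrite ge_min lexx. Qed.

Lemma power_utility_at0 h : (0 < h)%R ->
  power_utility h 0 = (real_utility h 0)%:E.
Proof. by move=> h0; rewrite power_utilityE//; right. Qed.

Lemma power_utility_le h x y : (h <= 1)%R -> (0 <= x <= y)%R ->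
  power_utility h x%:E <= power_utility h y%:E.
Proof.
move=> h1 /andP[x0 xy].
have [h0|h0] := leP h 0%R.
  have [->|xn0] := eqVneq x 0%R; first by rewrite power_utility0// leNye.
  have xp : (0 < x)%R by rewrite lt0r xn0.
  have yp := lt_le_trans xp xy.
  rewrite !power_utilityE ?(ltW xp) ?(ltW yp)//; [|by left..].
  rewrite lee_fin; have := real_utility_tangent R h y x h1 yp x0 (or_introl xp).
  have := powR_ge0 y (h - 1); nra.
rewrite !power_utilityE//; [|by lra|by right|by right].
rewrite lee_fin; have [y0|yn0] := eqVneq y 0%R.
  by rewrite (_ : x = y)//; lra.
have yp : (0 < y)%R by lra.
have := real_utility_tangent R h y x h1 yp x0 (or_intror h0).
have := powR_ge0 y (h - 1); nra.
Qed.

(** Above the cap the supporting line is horizontal, below it is the tangent of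
    the uncapped utility. *)
Lemma capped_tangent a h m : (0 <= a)%R -> (h <= 1)%R -> (0 < m)%R ->
  exists v s, [/\ capped_power_utility a h m%:E = v%:E, (0 <= s)%R &
    forall y, (0 <= y)%R ->
      capped_power_utility a h y%:E <= (v + s * (y - m))%:E].
Proof.
move=> a0 h1 m0.
have cm0 := cap_gt0 a m a0 m0.
exists (real_utility h (cap a m)).
exists (if cap a m == m then m `^ (h - 1) else 0)%R.
split.
- by rewrite capped_power_utilityE power_utilityE ?(ltW cm0)//; left.
- by case: ifP => // _; rewrite powR_ge0.
move=> y y0; rewrite capped_power_utilityE.
have [c0|c0] := eqVneq (cap a y) 0%R.
  have [h0|h0] := leP h 0%R.
    by rewrite c0 power_utility0// leNye.
  have := real_utility_tangent R h (cap a m) (cap a y) h1 cm0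
    (cap_ge0 a y a0 y0) (or_intror h0).
  rewrite power_utilityE ?cap_ge0//; last by right.
  rewrite lee_fin; have := powR_ge0 (cap a m) (h - 1); case: eqP => [->|_];
    last by rewrite c0; nra.
  by have := cap_le a y; nra.
have cy0 : (0 < cap a y)%R by rewrite lt0r c0 cap_ge0.
rewrite power_utilityE ?cap_ge0//; last by left.
have := real_utility_tangent R h (cap a m) (cap a y) h1 cm0
  (cap_ge0 a y a0 y0) (or_introl cy0).
rewrite lee_fin; have := powR_ge0 (cap a m) (h - 1); case: eqP => [->|cmm].
  by have := cap_le a y; nra.
have : (cap a y <= cap a m)%R.
  move: cmm; rewrite /cap; case: eqP => // _; case: (leP m) => // am _.
  by rewrite ge_min lexx orbT.
by nra.
Qed.

Lemma real_utility_le_ln h m : (h <= 0)%R -> (0 < m)%R ->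
  (real_utility h m <= ln m)%R.
Proof.
rewrite /real_utility; case: eqVneq => // hn0 h0 m0.
have hlt : (h < 0)%R by rewrite lt_neqAle hn0.
rewrite ler_ndivrMr// /powR gt_eqF//.
have := expR_ge1Dx (h * ln m)%R; lra.
Qed.

(** Right-continuity at [0], where there is no tangent to invoke. For [h <= 0]
    the utility is dominated by the logarithm; for [h > 0] the point is found
    by solving [(m^h - 1) / h < t]. *)
Lemma capped_at0 a h t : (0 <= a)%R -> (h <= 1)%R ->
  capped_power_utility a h 0%:E < t%:E ->
  exists2 m, (0 < m)%R & capped_power_utility a h m%:E < t%:E.
Proof.
move=> a0 h1.
have le m : (0 < m)%R -> capped_power_utility a h m%:E <= power_utility h m%:E.
  move=> m0; rewrite capped_power_utilityE; apply: power_utility_le => //.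
  by rewrite cap_ge0 ?(ltW m0)//= cap_le.
have [h0|h0] := leP h 0%R.
  move=> _; have m0 := expR_gt0 (t - 1); exists (expR (t - 1)) => //.
  apply: le_lt_trans (le _ m0) _; rewrite power_utilityE ?(ltW m0)//;
    last by left.
  by rewrite lte_fin (le_lt_trans (real_utility_le_ln h _ h0 m0))// expRK; lra.
rewrite capped_power_utilityE.
have -> : cap a 0 = 0%R.
  by rewrite /cap; case: eqP => // _; rewrite min_l// invr_ge0.
rewrite power_utility_at0// lte_fin /real_utility gt_eqF// powR0 ?gt_eqF// => H.
have s0 : (0 < (1 + h * t) / 2)%R.
  by move: H; rewrite ltr_pdivrMr//; lra.
exists (((1 + h * t) / 2) `^ h^-1)%R; first by rewrite powR_gt0.
apply: le_lt_trans (le _ _) _; first by rewrite powR_gt0.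
rewrite power_utilityE ?powR_ge0//; last by right.
rewrite lte_fin /real_utility gt_eqF// -powRrM mulVf ?gt_eqF//
  powRr1 ?(ltW s0)//.
by rewrite ltr_pdivrMr//; lra.
Qed.

Lemma measurable_lne : measurable_fun [set: \bar R] (@lne R).
Proof.
have E (z : \bar R) : lne z = (if z == +oo then +oo else
    if z <= 0 then -oo else (ln (fine z))%:E) :> \bar R.
  by case: z => [r| |] //=; rewrite ?leNye// -(@lee_fin R).
rewrite (_ : @lne R = (fun z : \bar R => if z == +oo then +oo else
    if z <= 0 then -oo else (ln (fine z))%:E)); last exact/funext.
apply: measurable_fun_ifT => //=; first exact: measurable_fun_eqe.
apply: measurable_fun_ifT => //=; first exact: measurable_fun_lee.
apply/measurable_EFinP; exact: measurableT_comp.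
Qed.

Lemma measurable_invr : measurable_fun [set: R] (@GRing.inv R).
Proof.
have -> : @GRing.inv R = (fun y => if (0 <= y)%R then y `^ (-1)
    else - ((- y) `^ (-1)))%R.
  apply/funext => y; case: (leP 0%R y) => y0; first by rewrite powR_inv1.
  by rewrite powR_inv1 ?invrN ?opprK// oppr_ge0 ltW.
apply: measurable_fun_ifT => //=; first exact: measurable_fun_ler.
apply: measurableT_comp => //.
exact: (@measurableT_comp _ _ _ _ _ _ (@powR R ^~ (-1)%R)).
Qed.

Lemma measurable_epow h : measurable_fun [set: \bar R] (epow h).
Proof.
rewrite /epow; case: (h < 0)%R; last exact: measurable_poweR.
have E (z : \bar R) : (poweR z (- h))^-1 = (fun w => if w == 0 then +oo else
    if w == +oo then 0 else (fine w)^-1%:E) (poweR z (- h)).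
  have := poweR_ge0 z (- h); move: (poweR z (- h)) => w.
  by case: w => [r| |]//= r0; rewrite inver; case: ifPn.
rewrite (_ : (fun z => _) = (fun w => if w == 0 then +oo else
    if w == +oo then 0 else (fine w)^-1%:E) \o
    (fun z : \bar R => poweR z (- h))); last first.
  by apply/funext => z /=; rewrite E.
apply: measurableT_comp; last exact: measurable_poweR.
apply: measurable_fun_ifT => //=; first exact: measurable_fun_eqe.
apply: measurable_fun_ifT => //=; first exact: measurable_fun_eqe.
apply/measurable_EFinP.
exact: (measurableT_comp measurable_invr).
Qed.

Lemma measurable_capped_power_utility a h :
  measurable_fun [set: \bar R] (capped_power_utility a h).
Proof.
apply: (@measurableT_comp _ _ _ _ _ _ (power_utility h)); last first.
  by apply: measurable_mine => //; exact: measurable_cst.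
rewrite /power_utility; case: (h == 0%R); first exact: measurable_lne.
apply: emeasurable_funM => //; apply: emeasurable_funB => //.
exact: measurable_epow.
Qed.

End utility.

(** * Losses *)

(** Nonnegative, nonincreasing, convex, lower semicontinuous functions of a
    nonnegative real, possibly infinite at [0] only. Convexity and monotonicity
    are encoded by supporting lines of slope [- s <= 0], which give midpoint
    convexity and lower semicontinuity at [m > 0] at once; continuity at [0]
    has to be asked for separately. *)
Record loss {R : realType} (V : R -> \bar R) : Prop := Loss {
  loss_ge0 : forall y, (0 <= y)%R -> 0 <= V y;
  loss_tangent : forall m, (0 < m)%R -> exists v s, [/\ V m = v%:E, (0 <= s)%R &
    forall y, (0 <= y)%R -> (v - s * (y - m))%:E <= V y];
  loss_at0 : forall t, t%:E < V 0%R -> exists2 m, (0 < m)%R & t%:E < V m;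
  measurable_loss : measurable_fun [set: R] V }.

(** For a utility that is bounded above, maximizing the expected utility
    amounts to minimizing the expected shortfall, a nonnegative function, whose
    integral always makes sense. *)
Definition shortfall {R : realType} (a h y : R) : \bar R :=
  capped_power_utility a h +oo - capped_power_utility a h y%:E.

Section loss.
Context {R : realType}.
Implicit Types (a h t x y : R) (V : R -> \bar R).

Lemma capped_power_utility_sup a h : (0 <= a)%R -> (h <= 1)%R ->
  (0 < a)%R \/ (h < 0)%R ->
  exists2 c : R, capped_power_utility a h +oo = c%:E &
    forall y, (0 <= y)%R -> capped_power_utility a h y%:E <= c%:E.
Proof.
move=> a0 h1 ah; have [aE|an0] := eqVneq a 0%R.
  have h0 : (h < 0)%R by case: ah => //; rewrite aE ltxx.
  exists (- h^-1)%R.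
    rewrite /capped_power_utility aE inve0 minxx /power_utility lt_eqF//.
    by rewrite /epow h0 poweRyr ?oppr_eq0 ?lt_eqF// invey add0e mulN1e.
  move=> y y0; rewrite capped_power_utilityE /cap aE eqxx.
  have [->|yn0] := eqVneq y 0%R; first by rewrite power_utility0 ?leNye ?ltW.
  have yp : (0 < y)%R by rewrite lt0r yn0.
  rewrite power_utilityE//; last by left.
  rewrite lee_fin /real_utility lt_eqF// mulrBl mul1r.
  have : (y `^ h / h <= 0)%R by rewrite mulr_ge0_le0 ?powR_ge0// invr_le0 ltW.
  lra.
have ap : (0 < a)%R by rewrite lt0r an0.
exists (real_utility h a^-1).
  rewrite /capped_power_utility inver (negbTE an0) min_r ?leey//.
  by rewrite power_utilityE ?invr_ge0//; left; rewrite invr_gt0.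
move=> y y0; rewrite capped_power_utilityE.
rewrite -power_utilityE ?invr_ge0//; last by left; rewrite invr_gt0.
apply: power_utility_le => //; rewrite cap_ge0//=.
by rewrite /cap (negbTE an0) ge_min lexx orbT.
Qed.

Lemma loss_shortfall a h : (0 <= a)%R -> (h <= 1)%R ->
  (0 < a)%R \/ (h < 0)%R -> loss (shortfall a h).
Proof.
move=> a0 h1 ah; have [c cE cle] := capped_power_utility_sup a h a0 h1 ah.
have shE y : shortfall a h y = c%:E - capped_power_utility a h y%:E.
  by rewrite /shortfall cE.
split.
- move=> y y0; rewrite shE; have := cle y y0.
  case: (capped_power_utility a h y%:E) => [u| |]//=.
    by rewrite !lee_fin; lra.
  by rewrite addey// leey.
- move=> m m0; have [v [s [vE s0 H]]] := capped_tangent a h m a0 h1 m0.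
  exists (c - v)%R, s; split => //; first by rewrite shE vE.
  move=> y y0; rewrite shE; have := H y y0.
  case: (capped_power_utility a h y%:E) => [u| |]//=.
    by rewrite !lee_fin; lra.
  by rewrite addey// leey.
- move=> t; rewrite shE => H.
  have [] := capped_at0 a h (c - t) a0 h1.
    move: H; case: (capped_power_utility a h 0%R%:E) => [u| |]//=.
      by rewrite !lte_fin; lra.
    by rewrite ltNye.
  move=> m m0 Hm; exists m => //; rewrite shE; move: Hm.
  case: (capped_power_utility a h m%:E) => [u| |]//=.
    by rewrite !lte_fin; lra.
  by rewrite addey// ltry.
- apply: emeasurable_funB; first exact: measurable_cst.
  exact: (measurableT_comp (measurable_capped_power_utility a h)).
Qed.

(** The loss behind the numeraire property. *)
Lemma loss_inv : loss (fun y : R => (y%:E)^-1).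
Proof.
split.
- by move=> y y0; rewrite inve_ge0 lee_fin.
- move=> m m0; exists m^-1%R, (m ^- 2)%R; split.
  + by rewrite inver gt_eqF.
  + by rewrite invr_ge0 exprn_ge0// ltW.
  + move=> y y0; rewrite inver; case: eqVneq => [_|yn0]; first by rewrite leey.
    have yp : (0 < y)%R by rewrite lt0r yn0.
    rewrite lee_fin -subr_ge0.
    have -> : (y^-1 - (m^-1 - m ^- 2 * (y - m)) =
        (y - m) ^+ 2 / (y * m ^+ 2))%R.
      by field; rewrite !gt_eqF.
    by rewrite divr_ge0 ?sqr_ge0// mulr_ge0 ?sqr_ge0.
- move=> t _; exists (`|t| + 1)^-1%R; first by rewrite invr_gt0 ltr_wpDl.
  rewrite inver gt_eqF ?invr_gt0 ?ltr_wpDl// invrK lte_fin.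
  by have := ler_norm t; lra.
- rewrite (_ : (fun y : R => _) =
      (fun y : R => if y == 0%R then +oo else (y^-1)%:E)); last first.
    by apply/funext => y; rewrite inver.
  apply: measurable_fun_ifT => //=; first exact: measurable_fun_eqr.
  apply/measurable_EFinP; exact: measurable_invr.
Qed.

Lemma loss_fin V m : loss V -> (0 < m)%R -> V m \is a fin_num.
Proof. by move=> lV m0; have [v [s [-> _ _]]] := loss_tangent _ lV m m0. Qed.

Lemma loss_le V x y : loss V -> (0 <= x)%R -> (x <= y)%R -> V y <= V x.
Proof.
move=> lV x0 xy; have [y0|yn0] := eqVneq y 0%R.
  by rewrite (_ : x = y)//; lra.
have yp : (0 < y)%R by rewrite lt0r yn0 (le_trans x0 xy).
have [v [s [-> s0 H]]] := loss_tangent _ lV y yp.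
by apply: le_trans (H x x0); rewrite lee_fin; nra.
Qed.

Lemma loss_midpoint V x y : loss V -> (0 <= x)%R -> (0 <= y)%R ->
  V ((x + y) / 2)%R + V ((x + y) / 2)%R <= V x + V y.
Proof.
move=> lV x0 y0; set m := ((x + y) / 2)%R.
have [m0|mn0] := eqVneq m 0%R.
  have x00 : x = 0%R by move: m0; rewrite /m; lra.
  have y00 : y = 0%R by move: m0; rewrite /m; lra.
  by rewrite m0 x00 y00.
have mp : (0 < m)%R by rewrite lt0r mn0 /m; lra.
have [v [s [-> s0 H]]] := loss_tangent _ lV m mp.
apply: le_trans (leeD (H x x0) (H y y0)).
by rewrite -!EFinD lee_fin /m; lra.
Qed.

Lemma limn_einf_ge (u : nat -> \bar R) (L : \bar R) :
  (forall t : R, t%:E < L -> \forall n \near \oo, t%:E <= u n) ->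
  L <= limn_einf u.
Proof.
move=> H; rewrite limn_einf_lim.
have key (t : R) : t%:E < L -> t%:E <= limn (einfs u).
  move=> tL; have [N _ HN] := H t tL.
  have cv : cvgn (einfs u) by exact: is_cvg_einfs.
  apply: lime_ge => //; exists N => // n /= Nn.
  apply: le_ereal_inf_tmp => _ [k /= nk <-]; apply: HN => /=.
  exact: leq_trans nk.
case: L H key => [l| |] H key; last by rewrite leNye.
  apply/lee_addgt0Pr => e e0; rewrite -leeBlDr//; apply: key.
  by rewrite lte_fin; lra.
by rewrite leye_eq; apply/eqP/eqyP => A A0; apply: key; rewrite ltry.
Qed.

(** Since [V] is nonincreasing, it suffices to find a point [m > y] with
    [t < V m]: the sequence is eventually below [m]. *)
Lemma loss_lsc V (u : nat -> R) y : loss V -> (forall n, (0 <= u n)%R) ->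
  (0 <= y)%R -> u n @[n --> \oo] --> y ->
  V y <= limn_einf (fun n => V (u n)).
Proof.
move=> lV u0 y0 uy; apply: limn_einf_ge => t tV.
have [m m0 [ym tm]] : exists2 m, (0 < m)%R & (y < m)%R /\ t%:E < V m.
  have [yE|yn0] := eqVneq y 0%R.
    move: tV; rewrite yE => tV.
    by have [m m0 Hm] := loss_at0 _ lV t tV; exists m.
  have yp : (0 < y)%R by rewrite lt0r yn0.
  have [v [s [vE s0 H]]] := loss_tangent _ lV y yp.
  move: tV; rewrite vE lte_fin => tv.
  have s1 : (0 < s + 1)%R by lra.
  have d0 : (0 < (v - t) / (s + 1))%R by rewrite divr_gt0// subr_gt0.
  exists (y + (v - t) / (s + 1))%R; first lra.
  split; first lra.
  apply: lt_le_trans (H _ _); last lra.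
  have : ((v - t) / (s + 1) * (s + 1) = v - t)%R by rewrite divfK// gt_eqF.
  rewrite lte_fin; nra.
have : \forall n \near \oo, (u n < m)%R by exact: (cvgr_lt y).
apply: filterS => n unm.
by apply: le_trans (ltW tm) _; apply: loss_le => //; exact: ltW.
Qed.

End loss.

(** * Real-valued e-values and convex closed sets *)

Section real_evalues.
Context {R : realType} {d : measure_display} {X : measurableType d}.
Implicit Types (H : set (probability X R)) (mu : {measure set X -> \bar R})
  (f g : X -> R) (e : X -> \bar R).

(** Real values make the convex combinations, quotients and powers of e-values
    unproblematic; [evalue_ae_fin] and [real_evalue_fine] show that nothing is
    lost up to [mu]-null events. *)
Definition real_evalue H (f : X -> R) : Prop := evalues H (EFin \o f).

Lemma measurable_real_evalue H f : real_evalue H f -> measurable_fun [set: X] f.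
Proof. by case=> /measurable_EFinP. Qed.

Lemma real_evalue_ge0 H f x : real_evalue H f -> (0 <= f x)%R.
Proof. by case=> _ /(_ x); rewrite lee_fin. Qed.

Lemma real_evalue_le H f g : real_evalue H g -> measurable_fun [set: X] f ->
  (forall x, (0 <= f x <= g x)%R) -> real_evalue H f.
Proof.
move=> gE mf fg; split.
- exact/measurable_EFinP.
- by move=> x; rewrite lee_fin; case/andP: (fg x).
- move=> P HP; case: (gE) => mg g0 /(_ P HP); apply: le_trans.
  apply: ge0_le_integral => //.
  + by move=> x _; rewrite lee_fin; case/andP: (fg x).
  + exact/measurable_EFinP.
  + by move=> x _; rewrite lee_fin; case/andP: (fg x).
Qed.

Lemma real_evalue_cst1 H : real_evalue H (fun=> 1%R).
Proof.
split => [||P _]; first exact/measurable_EFinP.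
- by move=> x; rewrite /= lee_fin.
- by rewrite integral_cst// mul1e probability_le1.
Qed.

Lemma real_evalue_mix H t f g : (0 <= t <= 1)%R -> real_evalue H f ->
  real_evalue H g -> real_evalue H (fun x => (1 - t) * f x + t * g x)%R.
Proof.
move=> /andP[t0 t1] fE gE; have s0 : (0 <= 1 - t)%R by lra.
have [mf f0 fP] := fE; have [mg g0 gP] := gE.
have mf' := measurable_real_evalue _ _ fE;
  have mg' := measurable_real_evalue _ _ gE.
split.
- by apply/measurable_EFinP; apply: measurable_funD;
    apply: measurable_funM => //.
- move=> x; by rewrite /= lee_fin addr_ge0// mulr_ge0// (real_evalue_ge0 H).
- move=> P HP.
  under eq_integral do rewrite /= EFinD !EFinM.
  rewrite ge0_integralD//; last 4 first.
  + by move=> x _; rewrite mule_ge0// f0.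
  + exact: measurable_funeM.
  + by move=> x _; rewrite mule_ge0// g0.
  + exact: measurable_funeM.
  rewrite !ge0_integralZl_EFin//;
    [|by move=> x _; exact: g0|by move=> x _; exact: f0].
  have A (c : R) (z : \bar R) : (0 <= c)%R -> z <= 1 -> c%:E * z <= c%:E.
    by move=> c0 z1; rewrite -[leRHS]mule1 lee_wpmul2l ?lee_fin.
  apply: le_trans (leeD (A _ _ s0 (fP P HP)) (A _ _ t0 (gP P HP))) _.
  by rewrite -EFinD lee_fin subrK.
Qed.

Lemma real_evalue_midpoint H f g : real_evalue H f -> real_evalue H g ->
  real_evalue H (fun x => (f x + g x) / 2)%R.
Proof.
move=> fE gE; rewrite (_ : (fun x => _) =
    fun x => ((1 - 2^-1) * f x + 2^-1 * g x)%R); last first.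
  by apply/funext => x; field.
by apply: real_evalue_mix => //; lra.
Qed.

(** The event where an e-value is infinite has probability zero under every [P]
    in [H], as its expectation is at most [1]; so the measure [mu], which does
    not charge such events, does not see it. *)
Lemma evalue_ae_fin H mu e : (forall N, null_event H N -> mu N = 0) ->
  evalues H e -> {ae mu, forall x, e x \is a fin_num}.
Proof.
move=> muH [me e0 eP]; exists (e @^-1` [set +oo]).
have mN : measurable (e @^-1` [set +oo]) by rewrite -[X in measurable X]setTI;
  exact: me.
split => //; last first.
  move=> x /= /negP; rewrite ge0_fin_numE//.
  by rewrite -leNgt leye_eq => /eqP.
apply: muH; split => // P HP.
have ie : P.-integrable setT e.
  apply/integrableP; split => //.
  under eq_integral do rewrite gee0_abs//.
  by rewrite (le_lt_trans (eP P HP))// ltry.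
have [N [mN' PN HN]] := integrable_ae measurableT ie.
apply/eqP; rewrite -measure_le0 -PN; apply: le_measure; rewrite ?inE//.
by move=> x /= ex; apply: HN => /= /(_ I); rewrite ex.
Qed.

Lemma real_evalue_fine H e : evalues H e -> real_evalue H (fine \o e).
Proof.
case=> me e0 eP.
have mfe : measurable_fun setT (EFin \o (fine \o e)).
  by apply/measurable_EFinP; exact: measurableT_comp.
have f0 x : 0 <= (EFin \o (fine \o e)) x by rewrite lee_fin fine_ge0.
split => // P HP; apply: le_trans (eP P HP).
apply: ge0_le_integral => // x _ /=.
by have := e0 x; case: (e x) => [r| |]//=; rewrite leey.
Qed.

(** Convexity is stated for midpoints because [countable_compactness] averages
    two elements at a time. The almost everywhere limit is required to be an
    e-value beforehand, because convergence [mu]-almost everywhere says nothing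
    about the measures in [H]. *)
Definition convex_closed H mu (C : set (X -> R)) : Prop :=
  [/\ C `<=` real_evalue H,
      forall f g, C f -> C g -> C (fun x => (f x + g x) / 2)%R
    & forall (u : nat -> X -> R) f, (forall n, C (u n)) -> real_evalue H f ->
        {ae mu, forall x, u n x @[n --> \oo] --> f x} -> C f].

Lemma limn_einf_le (u : nat -> \bar R) (L : \bar R) :
  (forall n, u n <= L) -> limn_einf u <= L.
Proof.
move=> H; rewrite limn_einf_lim; apply: lime_le; first exact: is_cvg_einfs.
apply: nearW => n; apply: le_trans (H n); apply: ereal_inf_lbound.
by exists n => /=.
Qed.

Lemma measurable_limn_einf (u : nat -> X -> \bar R) :
  (forall n, measurable_fun [set: X] (u n)) ->
  measurable_fun [set: X] (fun x => limn_einf (u ^~ x)).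
Proof.
move=> mu; rewrite /limn_einf; apply: measurableT_comp => //.
apply: (@measurable_fun_limn_esup _ _ _ setT (fun n x => - u n x)) => n.
by apply: measurableT_comp.
Qed.

(** Absorbing the weight into the loss lets [sublevel_convex_closed] apply the
    pointwise properties of losses, including when [w = 0] and the loss is
    infinite. *)
Lemma loss_scale (V : R -> \bar R) w : loss V -> (0 <= w)%R ->
  loss (fun y => w%:E * V y).
Proof.
move=> lV; have [->|wn0] := eqVneq w 0%R => w0.
  split.
  - by move=> y _; rewrite mul0e.
  - move=> m m0; exists 0%R, 0%R; split => //; first by rewrite mul0e.
    by move=> y _; rewrite mul0e !mul0r subr0.
  - by move=> t; rewrite mul0e => t0; exists 1%R => //; rewrite mul0e.
  - by under eq_fun do rewrite mul0e; exact: measurable_cst.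
have wp : (0 < w)%R by rewrite lt0r wn0.
split.
- by move=> y y0; rewrite mule_ge0// loss_ge0.
- move=> m m0; have [v [s [-> s0 H]]] := loss_tangent _ lV m m0.
  exists (w * v)%R, (w * s)%R; split => //; first by rewrite mulr_ge0.
  move=> y y0; rewrite -mulrA -mulrBr EFinM; exact: lee_wpmul2l (H y y0).
- move=> t; rewrite muleC -lte_pdivrMr// -EFinM.
  move=> /(loss_at0 _ lV)[m m0 Hm]; exists m => //.
  by rewrite muleC -lte_pdivrMr.
- apply: measurable_funeM; exact: measurable_loss.
Qed.

(** Midpoint convexity of the integrand gives convexity, its lower
    semicontinuity and Fatou's lemma give closedness. *)
Lemma sublevel_convex_closed H mu (V : R -> \bar R) (w : X -> R) (v : R) :
  loss V -> measurable_fun [set: X] w -> (forall x, (0 <= w x)%R) ->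
  convex_closed H mu [set f | real_evalue H f /\
    \int[mu]_x ((w x)%:E * V (f x)) <= v%:E].
Proof.
move=> lV mw w0.
have mwV f : measurable_fun setT f ->
    measurable_fun setT (fun x => (w x)%:E * V (f x)).
  move=> mf; apply: emeasurable_funM; first exact/measurable_EFinP.
  by apply: measurableT_comp => //; exact: measurable_loss.
have wV0 f : real_evalue H f -> forall x, 0 <= (w x)%:E * V (f x).
  by move=> fE x; rewrite mule_ge0 ?lee_fin// loss_ge0// (real_evalue_ge0 H).
split => [f []//|f g [fE fv] [gE gv]|u f uC fE uf].
  have mE := real_evalue_midpoint H f g fE gE; split => //.
  have mf := measurable_real_evalue _ _ fE;
    have mg := measurable_real_evalue _ _ gE.
  have mm := measurable_real_evalue _ _ mE.
  set I := (X in X <= _).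
  have : I + I <= v%:E + v%:E.
    apply: le_trans (leeD fv gv).
    have If := wV0 _ fE; have Ig := wV0 _ gE; have Im := wV0 _ mE.
    rewrite /I -!ge0_integralD//; try exact: mwV.
    apply: ge0_le_integral => //.
    - by move=> x _; apply: adde_ge0; exact: (wV0 _ mE).
    - by apply: emeasurable_funD; exact: (mwV _ mm).
    - by apply: emeasurable_funD; exact: mwV.
    move=> x _; apply: (@loss_midpoint R (fun y => (w x)%:E * V y)).
    - exact: loss_scale.
    - exact: real_evalue_ge0 fE.
    - exact: real_evalue_ge0 gE.
  case: I => [r| |] /=.
  - by rewrite !lee_fin; lra.
  - by rewrite -EFinD leye_eq.
  - by rewrite !leNye.
split => //.
have uE n : real_evalue H (u n) by case: (uC n).
have mu_ n : measurable_fun setT (u n) by apply: measurable_real_evalue (uE n).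
have mf := measurable_real_evalue _ _ fE.
apply: (@le_trans _ _ (\int[mu]_x limn_einf (fun n => (w x)%:E * V (u n x)))).
  apply: ae_ge0_le_integral => //.
  - by move=> x _; exact: wV0.
  - exact: mwV.
  - move=> x _; apply: limn_einf_ge => t t0; apply: nearW => n.
    by apply: le_trans (ltW t0) _; exact: wV0.
  - apply: (@measurable_limn_einf (fun n x => (w x)%:E * V (u n x))) => n.
    exact: mwV.
  - apply: filterS uf => x ux _.
    apply: (@loss_lsc R (fun y => (w x)%:E * V y)) => //.
    + exact: loss_scale.
    + by move=> n; apply: real_evalue_ge0 (uE n).
    + exact: real_evalue_ge0 fE.
apply: le_trans (fatou _ _ _ _) _ => //.
- by move=> n; exact: mwV.
- by move=> n x _; exact: wV0.
by apply: limn_einf_le => n; case: (uC n).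
Qed.

End real_evalues.

(** * Countable compactness *)

Section compactness.
Context {R : realType} {d : measure_display} {X : measurableType d}.
Context (H : set (probability X R)) (mu : {measure set X -> \bar R}).
Hypothesis mu_fin : mu [set: X] < +oo.
Hypothesis mu_null : forall N, null_event H N -> mu N = 0.
Implicit Types (f g : X -> R) (e : R).

Let M := fine (mu [set: X]).

Let ME : mu [set: X] = M%:E.
Proof. by rewrite fineK// ge0_fin_numE. Qed.

(** A bounded, strictly convex function of [f]. *)
Let phi (f : X -> R) (x : X) : R := (1 + f x)^-1%R.
Let mphi (f : X -> R) : R := fine (\int[mu]_x (phi f x)%:E).

Let measurable_phi f : real_evalue H f -> measurable_fun [set: X] (phi f).
Proof.
move=> fE; apply: (measurableT_comp measurable_invr).
by apply: measurable_funD => //; exact: measurable_real_evalue fE.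
Qed.

Let phi01 f x : real_evalue H f -> (0 < phi f x <= 1)%R.
Proof.
move=> fE; have := real_evalue_ge0 _ _ x fE => f0.
by rewrite /phi invr_gt0 invf_le1; lra.
Qed.

Let mphiE (f : X -> R) : real_evalue H f ->
  \int[mu]_x (phi f x)%:E = (mphi f)%:E.
Proof.
move=> fE; rewrite /mphi fineK// ge0_fin_numE; last first.
  by apply: integral_ge0 => x _; rewrite lee_fin; have := phi01 _ x fE; lra.
apply: le_lt_trans (_ : \int[mu]_x 1 < +oo).
  apply: ge0_le_integral => //.
  - by move=> x _; rewrite lee_fin; have := phi01 _ x fE; lra.
  - exact/measurable_EFinP/measurable_phi.
  - by move=> x _; rewrite lee_fin; have := phi01 _ x fE; lra.
by rewrite integral_cst// mul1e.
Qed.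

(** A quantitative form of the strict convexity of [t |-> 1 / (1 + t)]: with
    [u], [v], [m] the values at two points and at their midpoint,
    [(u - v)^2 + 4 m <= 2 (u + v)]. The square is then traded for an absolute
    value, at the price of the free parameter [e], so that the estimate can be
    summed. *)
Let gap_pointwise (f g : X -> R) x e : (0 < e)%R -> real_evalue H f ->
  real_evalue H g ->
  (`|phi f x - phi g x| + 4 / e * phi (fun x => (f x + g x) / 2) x
   <= 2 / e * (phi f x + phi g x) + e)%R.
Proof.
move=> e0 fE gE.
have f0 := real_evalue_ge0 _ _ x fE; have g0 := real_evalue_ge0 _ _ x gE.
set u := phi f x; set v := phi g x; set m := phi _ x.
have sq : ((u - v) ^+ 2 + 4 * m <= 2 * (u + v))%R.
  rewrite -subr_ge0.
  have -> : (2 * (u + v) - ((u - v) ^+ 2 + 4 * m) =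
     (f x - g x) ^+ 2 * (2 * (1 + f x) * (1 + g x) - (2 + f x + g x)) /
     ((2 + f x + g x) * (1 + f x) ^+ 2 * (1 + g x) ^+ 2))%R.
    rewrite /u /v /m /phi; field.
    by apply/and3P; split; apply: lt0r_neq0; lra.
  apply: divr_ge0; first by apply: mulr_ge0; [exact: sqr_ge0|nra].
  by rewrite !mulr_ge0 ?sqr_ge0//; lra.
have am : (`|u - v| <= (u - v) ^+ 2 / e + e)%R.
  rewrite -(real_normK (num_real (u - v)%R)); set z := (`|u - v|)%R.
  have z0 : (0 <= z)%R by exact: normr_ge0.
  rewrite -subr_ge0.
  have -> : (z ^+ 2 / e + e - z = (z ^+ 2 + e ^+ 2 - e * z) / e)%R.
    by field; rewrite gt_eqF.
  by apply: divr_ge0; [nra|exact: ltW].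
apply: le_trans (lerD am (lexx _)) _.
have -> : ((u - v) ^+ 2 / e + e + 4 / e * m = ((u - v) ^+ 2 + 4 * m) / e + e)%R
  by ring.
have -> : (2 / e * (u + v) + e = 2 * (u + v) / e + e)%R by ring.
by rewrite lerD2r ler_pM2r ?invr_gt0.
Qed.

Let gap f g e : (0 < e)%R -> real_evalue H f -> real_evalue H g ->
  \int[mu]_x (`|phi f x - phi g x|)%:E <=
  (2 / e * (mphi f + mphi g) + e * M
   - 4 / e * mphi (fun x => (f x + g x) / 2)%R)%:E.
Proof.
move=> e0 fE gE; have mE := real_evalue_midpoint H f g fE gE.
rewrite EFinB leeBrDr//.
have c0 (c : R) : (0 < c)%R -> (0 <= c / e)%R by move=> ?;
  rewrite divr_ge0// ltW.
have a0 h x : real_evalue H h -> 0 <= (phi h x)%:E.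
  by move=> hE; rewrite lee_fin; have := phi01 _ x hE; lra.
have mae h : real_evalue H h -> measurable_fun setT (fun x => (phi h x)%:E).
  by move=> hE; apply/measurable_EFinP/measurable_phi.
have mn : measurable_fun setT (fun x => (`|phi f x - phi g x|)%:E).
  apply/measurable_EFinP; apply: measurableT_comp => //.
  by apply: measurable_funB; exact: measurable_phi.
rewrite (EFinM (4 / e)%R) -(mphiE _ mE) -ge0_integralZl_EFin//;
  [|by move=> x _; exact: a0|exact: mae|exact: c0].
rewrite -ge0_integralD//; last 2 first.
- by move=> x _; rewrite mule_ge0 ?a0// lee_fin c0.
- by apply: measurable_funeM; exact: mae.
rewrite EFinD (EFinM (2 / e)%R) (EFinM e) (EFinD (mphi f)) -(mphiE _ fE)
  -(mphiE _ gE) -ME.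
rewrite -ge0_integralD//; last 4 first.
- by move=> x _; exact: a0.
- exact: mae.
- by move=> x _; exact: a0.
- exact: mae.
rewrite -ge0_integralZl_EFin//; last 3 first.
- by move=> x _; apply: adde_ge0; exact: a0.
- by apply: emeasurable_funD; exact: mae.
- exact: c0.
rewrite -(integral_cst mu measurableT e%:E) -ge0_integralD//; last 3 first.
- by move=> x _; apply: mule_ge0; [rewrite lee_fin c0|apply: adde_ge0;
    exact: a0].
- by apply: measurable_funeM; apply: emeasurable_funD; exact: mae.
- by move=> x _; rewrite lee_fin ltW.
apply: ge0_le_integral => //.
- by move=> x _; apply: adde_ge0; [rewrite lee_fin|apply: mule_ge0;
    [rewrite lee_fin c0|exact: a0]].
- by apply: emeasurable_funD => //; apply: measurable_funeM; exact: mae.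
- apply: emeasurable_funD; last exact: measurable_cst.
  by apply: measurable_funeM; apply: emeasurable_funD; exact: mae.
- by move=> x _; have := gap_pointwise f g x e e0 fE gE; rewrite -lee_fin.
Qed.

Let summable_ae (u : nat -> X -> R) (c : R) : (0 <= c)%R ->
  (forall n, measurable_fun [set: X] (u n)) -> (forall n x, (0 <= u n x)%R) ->
  (forall n, \int[mu]_x (u n x)%:E <= (c / (2 ^ n.+1)%:R)%:E) ->
  {ae mu, forall x, cvgn (series (u ^~ x))}.
Proof.
move=> c0 mu_ u0 uc.
have mU n : measurable_fun setT (fun x => (u n x)%:E) by exact/measurable_EFinP.
have S0 x : 0 <= \sum_(n <oo) (u n x)%:E.
  by apply: nneseries_ge0 => n _ _; rewrite lee_fin.
have iS : mu.-integrable setT (fun x => \sum_(n <oo) (u n x)%:E).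
  apply/integrableP; split.
    by apply: ge0_emeasurable_sum => // n x _ _; rewrite lee_fin.
  under eq_integral do rewrite gee0_abs//.
  rewrite integral_nneseries//; last by move=> n x _; rewrite lee_fin.
  apply: le_lt_trans (_ : c%:E < +oo); last by rewrite ltry.
  apply: le_trans (epsilon_trick0 xpredT c0).
  apply: lee_nneseries => n _ //; first by rewrite integral_ge0// => x _;
    rewrite lee_fin.
have := integrable_ae measurableT iS; apply: filterS => x /(_ I) Sx.
apply: nondecreasing_is_cvgn.
  by apply/nondecreasing_seqP => n; rewrite seriesSr lerDl.
exists (fine (\sum_(n <oo) (u n x)%:E)) => _ [n _ <-].
rewrite -lee_fin fineK// /series/= -sumEFin.
by apply: nneseries_lim_ge => k _ _; rewrite lee_fin.
Qed.

(** To be used with [J] the supremum over [n] of the infimum of [mphi] on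
    [A n]. The midpoint of [g k] and [g k.+1] lies in the larger of the two
    sets they come from, so that its [mphi]-value is at least [J - 4^-(k+1)],
    while those of [g k] and [g k.+1] exceed [J] by at most [4^-(k+1)]. With
    [e = 2^-(k+1)] in [gap], the distance of consecutive terms is then of order
    [2^-k]. *)
Let gap_sum (J : R) (g : nat -> X -> R) (N : nat -> nat)
  (A : nat -> set (X -> R)) :
  (forall n, A n `<=` real_evalue H) ->
  (forall m n, (m <= n)%N -> A n `<=` A m) ->
  (forall n f f', A n f -> A n f' -> A n (fun x => (f x + f' x) / 2)%R) ->
  (forall k, A (N k) (g k)) ->
  (forall k f, A (N k) f -> (J - (2 ^ k.+1)%:R ^- 2 <= mphi f)%R) ->
  (forall k, (mphi (g k) <= J + (2 ^ k.+1)%:R ^- 2)%R) ->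
  {ae mu, forall x, cvgn (fun k => phi (g k) x)}.
Proof.
move=> AE Adec Amid Ag lb ub.
have gE k : real_evalue H (g k) by apply: AE (Ag k).
pose e k : R := ((2 ^ k.+1)%:R^-1)%R.
have ep k : (0 < e k)%R by rewrite invr_gt0 ltr0n expn_gt0.
have ee k : ((2 ^ k.+1)%:R ^- 2 = e k ^+ 2 :> R)%R by rewrite exprVn.
have edec k : (e k.+1 <= e k)%R.
  by rewrite lef_pV2 ?posrE ?ltr0n ?expn_gt0// ler_nat leq_exp2l.
have M0 : (0 <= M)%R by rewrite fine_ge0.
have bound k : \int[mu]_x (`|phi (g k.+1) x - phi (g k) x|)%:E <=
    ((8 + M) / (2 ^ k.+1)%:R)%:E.
  apply: le_trans (gap _ _ _ (ep k) (gE k.+1) (gE k)) _; rewrite lee_fin.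
  set m := (fun x => _).
  have Im : (J - e k ^+ 2 <= mphi m)%R.
    (* The larger of the two sets is that of the smaller index, which may be
       either one. *)
    have [le|lt] := leqP (N k) (N k.+1).
      rewrite -ee; apply: lb; apply: Amid => //; exact: (Adec _ _ le).
    apply: (@le_trans _ _ (J - e k.+1 ^+ 2)%R).
      by have := edec k; have := ep k.+1; nra.
    by rewrite -ee; apply: lb; apply: Amid => //; exact: (Adec _ _ (ltnW lt)).
  have I1 : (mphi (g k.+1) <= J + e k ^+ 2)%R.
    have := ub k.+1; rewrite ee.
    by have := edec k; have := ep k.+1; nra.
  have I0 : (mphi (g k) <= J + e k ^+ 2)%R by have := ub k; rewrite ee.
  have -> : ((8 + M) / (2 ^ k.+1)%:R = 2 / e k * (4 * e k ^+ 2) + e k * M)%R.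
    by rewrite -/(e k); field; rewrite gt_eqF.
  have : (2 / e k * (mphi (g k.+1) + mphi (g k)) - 4 / e k * mphi m
      <= 2 / e k * (4 * e k ^+ 2))%R.
    have -> : (4 / e k * mphi m = 2 / e k * (2 * mphi m))%R by ring.
    rewrite -mulrBr ler_wpM2l ?divr_ge0 ?(ltW (ep k))//; lra.
  lra.
have c0 : (0 <= 8 + M)%R by lra.
have := summable_ae (fun k x => `|phi (g k.+1) x - phi (g k) x|)%R _ c0 _ _
  bound.
move=> H0; have {H0} : {ae mu, forall x,
    cvgn (series (fun k => `|phi (g k.+1) x - phi (g k) x|%R))}.
  apply: H0 => [n|n x]; last exact: normr_ge0.
  apply: measurableT_comp => //; apply: measurable_funB; exact: measurable_phi.
apply: filterS => x Sx.
have /normed_cvg cs : cvgn [normed series (telescope (fun k => phi (g k) x) :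
  R^o ^nat)].
  exact: Sx.
rewrite (_ : (fun k => phi (g k) x) = (fun k => phi (g 0%N) x +
    series (telescope (fun k => phi (g k) x)) k)%R); last first.
  by apply/funext => k; rewrite -eq_sum_telescope.
by apply: is_cvgD => //; exact: is_cvg_cst.
Qed.

(** The lower limit of the sequence is an e-value by Fatou's lemma under each
    [P] in [H], hence finite [mu]-almost everywhere; this excludes that [phi]
    tends to [0], that is, that the sequence itself tends to infinity. *)
Let limit_real_evalue (g : nat -> X -> R) :
  (forall k, real_evalue H (g k)) ->
  {ae mu, forall x, cvgn (fun k => phi (g k) x)} ->
  exists2 f, real_evalue H f & {ae mu, forall x, g n x @[n --> \oo] --> f x}.
Proof.
move=> gE ca; pose G x := limn_einf (fun k => (g k x)%:E).
have mg k : measurable_fun setT (fun x => (g k x)%:E) by case: (gE k).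
have GE : evalues H G.
  split.
  - exact: (@measurable_limn_einf _ _ _ (fun k x => (g k x)%:E)).
  - move=> x; apply: limn_einf_ge => t t0; apply: nearW => n.
    by apply: le_trans (ltW t0) _; rewrite lee_fin (real_evalue_ge0 H).
  - move=> P HP; apply: le_trans (fatou _ _ _ _) _ => //.
      by move=> n x _; rewrite lee_fin (real_evalue_ge0 H).
    by apply: limn_einf_le => n; case: (gE n) => _ _; exact.
exists (fine \o G); first exact: real_evalue_fine.
apply: filterS2 ca (evalue_ae_fin H mu G mu_null GE) => x cax Gx /=.
have g0 k : (0 <= g k x)%R by apply: real_evalue_ge0 (gE k).
set l := lim (phi (g k) x @[k --> \oo]) in cax.
have l0 : (0 <= l)%R.
  by apply: limr_ge => //; apply: nearW => k; have := phi01 _ x (gE k); lra.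
have [lE|ln0] := eqVneq l 0%R.
  exfalso; move: Gx; suff -> : G x = +oo by [].
  apply/eqP; rewrite -leye_eq; apply: limn_einf_ge => t _.
  (* If [phi (g k) x] tends to [0], the lower limit exceeds every real [t]. *)
  pose t' := (`|t| + 1)%R; have t'0 : (0 < t')%R by rewrite ltr_wpDl.
  have : \forall k \near \oo, (phi (g k) x < t'^-1)%R.
    by apply: (cvgr_lt l) => //; rewrite lE invr_gt0.
  apply: filterS => k; rewrite /phi ltf_pV2 ?posrE//; last by rewrite ltr_pwDl.
  rewrite lee_fin /t'; have := ler_norm t; lra.
have cg : (g k x) @[k --> \oo] --> (l^-1 - 1)%R.
  rewrite (_ : (fun k => g k x) = (fun k => (phi (g k) x)^-1 - 1)%R);
    last first.
    by apply/funext => k; rewrite /phi invrK; ring.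
  by apply: cvgB; [apply: cvgV|exact: cvg_cst].
have -> : G x = (l^-1 - 1)%:E.
  by apply: (cvg_limn_einf_sup _).1; apply: cvg_EFin => //; exact: nearW.
exact: cg.
Qed.

(** The infimum of [mphi] over the finite intersections [A n] increases to some
    [J]. Elements [g k] of [A (N k)] that nearly attain [J], with [N k >= k] so
    large that the infimum over [A (N k)] is close to [J] as well, converge
    almost everywhere, and the limit is in every [C k] because all but finitely
    many terms are. *)
Theorem countable_compactness (C : nat -> set (X -> R)) :
  (forall k, convex_closed H mu (C k)) ->
  (forall n, exists f, forall k, (k <= n)%N -> C k f) ->
  exists f, forall k, C k f.
Proof.
move=> CC Cne; pose A n : set (X -> R) :=
  [set f | forall k, (k <= n)%N -> C k f].
have AE n : A n `<=` real_evalue H.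
  by move=> f Af; case: (CC 0%N) => + _ _; apply; exact: Af.
have Adec m n : (m <= n)%N -> A n `<=` A m.
  by move=> mn f Af k km; apply: Af; exact: leq_trans mn.
have Amid n f f' : A n f -> A n f' -> A n (fun x => (f x + f' x) / 2)%R.
  by move=> Af Af' k kn; case: (CC k) => _ + _; apply; [exact: Af|exact: Af'].
pose S : set R := [set t | exists N, forall f, A N f -> (t <= mphi f)%R].
have S0 : S 0%R.
  exists 0%N => f Af; apply: fine_ge0; apply: integral_ge0 => x _.
  by rewrite lee_fin; have := phi01 _ x (AE _ _ Af); lra.
have Sub : has_ubound S.
  exists M => t [N Nt]; have [f Af] := Cne N; apply: (le_trans (Nt f Af)).
  have fE := AE _ _ Af.
  rewrite -lee_fin -mphiE// -ME -[leRHS]mul1e -(integral_cst mu measurableT 1).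
  apply: ge0_le_integral => //.
  - by move=> x _; rewrite lee_fin; have := phi01 _ x fE; lra.
  - exact/measurable_EFinP/measurable_phi.
  - by move=> x _; rewrite lee_fin; have := phi01 _ x fE; lra.
have supS : has_sup S by split => //; exists 0%R.
pose J := sup S.
have step k : exists p : nat * (X -> R), [/\ (k <= p.1)%N, A p.1 p.2,
    (forall f, A p.1 f -> J - (2 ^ k.+1)%:R ^- 2 <= mphi f)%R
  & (mphi p.2 <= J + (2 ^ k.+1)%:R ^- 2)%R].
  have e0 : (0 < (2 ^ k.+1)%:R ^- 2 :> R)%R.
    by rewrite invr_gt0 exprn_gt0// ltr0n expn_gt0.
  have [t [N Nt] tJ] := sup_adherent e0 supS.
  have [f [Af If]] : exists f,
      A (maxn k N) f /\ (mphi f <= J + (2 ^ k.+1)%:R ^- 2)%R.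
    apply: contrapT => nex.
    have : (J + (2 ^ k.+1)%:R ^- 2 <= J)%R.
      apply: ub_le_sup => //; exists (maxn k N) => f Af.
      rewrite leNgt; apply/negP => lt; apply: nex; exists f; split => //.
      exact: ltW.
    lra.
  exists (maxn k N, f); split => //=; first exact: leq_maxl.
  move=> f' Af'; apply: le_trans (ltW tJ) _; apply: Nt.
  by apply: Adec Af'; exact: leq_maxr.
have [p pP] := choice step.
pose N k := (p k).1; pose g k := (p k).2.
have Ag k : A (N k) (g k) by case: (pP k).
have kN k : (k <= N k)%N by case: (pP k).
have gE k : real_evalue H (g k) by apply: AE (Ag k).
have cg : {ae mu, forall x, cvgn (fun k => phi (g k) x)}.
  by apply: (gap_sum J g N A) => // k; case: (pP k).
have [f fE gf] := limit_real_evalue g gE cg.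
exists f => k; case: (CC k) => _ _; apply.
- by move=> n; apply: (Ag (n + k)%N); apply: leq_trans (kN _); exact: leq_addl.
- exact: fE.
- by apply: filterS gf => x gx; rewrite (cvg_shiftn k (fun n => g n x)).
Qed.

End compactness.

(** * From inequalities between integrals to optimality *)

Section optimality.
Context {R : realType} {d : measure_display} {X : measurableType d}.
Implicit Types (f g : X -> R) (mu : {measure set X -> \bar R}).

(** All optimality claims reduce to this form: the difference of utilities is
    written as [B - A], with [A] integrable and [B] nonnegative but possibly of
    infinite integral, so that the negative part is dominated by [A]. *)
Lemma expectation_sub_ge0_ae mu (u v B : X -> \bar R) (A : X -> R) :
  measurable_fun [set: X] u -> measurable_fun [set: X] v ->
  measurable_fun [set: X] A -> measurable_fun [set: X] B ->
  (forall x, (0 <= A x)%R) -> (forall x, 0 <= B x) ->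
  {ae mu, forall x, u x +? - v x /\ u x - v x = B x - (A x)%:E} ->
  \int[mu]_x (A x)%:E < +oo -> \int[mu]_x (A x)%:E <= \int[mu]_x B x ->
  expectation_sub_ge0 mu u v.
Proof.
move=> mu_ mv mA mB A0 B0 uv IA IAB.
pose D x := u x - v x.
have mD : measurable_fun setT D by exact: emeasurable_funB.
have mDp : measurable_fun setT D^\+ by exact: measurable_funepos.
have mDn : measurable_fun setT D^\- by exact: measurable_funeneg.
have mEA : measurable_fun setT (fun x => (A x)%:E) by exact/measurable_EFinP.
have EA0 x : 0 <= (A x)%:E by rewrite lee_fin.
have In : \int[mu]_x D^\- x <= \int[mu]_x (A x)%:E.
  apply: ae_ge0_le_integral => //.
  apply: filterS uv => x [_ E] _; rewrite funenegE /D E.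
  rewrite ge_max lee_fin A0 andbT; have := B0 x.
  case: (B x) => [b| |]//=; last by rewrite leNye.
  by rewrite !lee_fin; lra.
have IA0 : 0 <= \int[mu]_x (A x)%:E by exact: integral_ge0.
have finA : \int[mu]_x (A x)%:E \is a fin_num by rewrite ge0_fin_numE.
have finD : \int[mu]_x D^\- x \is a fin_num.
  by rewrite ge0_fin_numE ?integral_ge0// (le_lt_trans In).
split.
- by apply: filterS uv => x [].
- by right; exact: le_lt_trans In IA.
rewrite -[leRHS]/(\int[mu]_x D x) integralE suber_ge0// -(leeD2rE _ _ finA).
apply: (@le_trans _ _ (\int[mu]_x B x + \int[mu]_x D^\- x)).
  by rewrite [leLHS]addeC; apply: leeD2r.
rewrite -!ge0_integralD//; apply: ae_ge0_le_integral => //.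
- by move=> x _; apply: adde_ge0.
- exact: emeasurable_funD.
- by move=> x _; apply: adde_ge0.
- exact: emeasurable_funD.
apply: filterS uv => x [_ E] _; rewrite funeposE funenegE /D E.
have := B0 x; case: (B x) => [b| |]//=.
  rewrite -!EFin_max -!EFinD !lee_fin => b0.
  by case: (leP (- (b - A x)) 0)%R; case: (leP (b - A x) 0)%R; lra.
by move=> _; rewrite maxye [leRHS]addye// leey.
Qed.

Lemma vanishing_sequence : exists c : nat -> R, [/\ forall k, (0 < c k)%R,
  forall k n, (k <= n)%N -> (c n <= c k)%R &
  forall e : R, (0 < e)%R -> exists k, (c k < e)%R].
Proof.
exists (fun k => k.+1%:R^-1)%R; split=> [k|k n kn|e e0];
  first by rewrite invr_gt0.
  by rewrite lef_pV2 ?posrE// ler_nat.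
have [N _ HN] := near_infty_natSinv_lt (PosNum e0).
by exists N; exact: (HN N (leqnn N)).
Qed.

(** A common point of the sublevel sets whose levels decrease to the infimum;
    the infimum is finite thanks to the constant e-value [1]. *)
Lemma loss_minimizer H mu (V : R -> \bar R) :
  mu [set: X] < +oo -> (forall N, null_event H N -> mu N = 0) -> loss V ->
  exists f, [/\ real_evalue H f, \int[mu]_x V (f x) < +oo &
    forall g, real_evalue H g -> \int[mu]_x V (f x) <= \int[mu]_x V (g x)].
Proof.
move=> muT mu0 lV.
pose S := [set \int[mu]_x V (f x) | f in real_evalue H].
have S0 : 0 <= ereal_inf S.
  apply: le_ereal_inf_tmp => _ [f fE <-]; apply: integral_ge0 => x _.
  by apply: loss_ge0 => //; exact: real_evalue_ge0 fE.
have I1 : \int[mu]_x V 1%R < +oo.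
  rewrite integral_cst// -(fineK (loss_fin V 1%R lV ltr01)).
  by rewrite -(fineK (_ : mu setT \is a fin_num)) ?ltry// ge0_fin_numE.
have Sfin : ereal_inf S \is a fin_num.
  rewrite ge0_fin_numE//; apply: le_lt_trans I1; apply: ereal_inf_lbound.
  by exists (fun=> 1%R) => //; exact: real_evalue_cst1.
have [c [c0 cdec csmall]] := vanishing_sequence.
pose C k := [set f | real_evalue H f /\
    \int[mu]_x ((1%R)%:E * V (f x)) <= (fine (ereal_inf S) + c k)%R%:E].
have [|n|f fC] := countable_compactness H mu muT mu0 C.
- move=> k; apply: (sublevel_convex_closed H mu V (fun=> 1%R)) => //.
- have [_ [f fE <-] If] := lb_ereal_inf_adherent (c0 n) Sfin.
  exists f => k kn; split => //; under eq_integral do rewrite mul1e.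
  apply: (le_trans (ltW If)); rewrite EFinD fineK// leeD2l//.
  by rewrite lee_fin cdec.
have fE : real_evalue H f by case: (fC 0%N).
have fS : \int[mu]_x V (f x) <= ereal_inf S.
  rewrite -(fineK Sfin); apply/lee_addgt0Pr => e e0.
  have [k ke] := csmall e e0.
  have [_ +] := fC k; under eq_integral do rewrite mul1e.
  by move=> /le_trans; apply; rewrite -EFinD lee_fin lerD2l ltW.
exists f; split => //.
- by apply: (le_lt_trans fS); rewrite -ge0_fin_numE.
- by move=> g gE; apply: (le_trans fS); apply: ereal_inf_lbound; exists g.
Qed.

End optimality.

(** * Utilities that are bounded above *)

Section capped.
Context {R : realType} {d : measure_display} {X : measurableType d}.
Context (H : set (probability X R)) (mu : {measure set X -> \bar R}).
Hypothesis mu_fin : mu [set: X] < +oo.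
Hypothesis mu_null : forall N, null_event H N -> mu N = 0.
Implicit Types (f g : X -> R) (a h : R).

Lemma cap_idem a y : cap a (cap a y) = cap a y :> R.
Proof. by rewrite /cap; case: eqP => // _; rewrite -minA minxx. Qed.

Lemma shortfall_cap a h y : shortfall a h (cap a y) = shortfall a h y.
Proof. by rewrite /shortfall !capped_power_utilityE cap_idem. Qed.

Lemma measurable_cap a : measurable_fun [set: R] (cap a).
Proof.
rewrite /cap; case: (a == 0%R) => //.
exact: measurable_minr.
Qed.

Lemma real_evalue_cap a f : (0 <= a)%R -> real_evalue H f ->
  real_evalue H (fun x => cap a (f x)).
Proof.
move=> a0 fE; apply: (real_evalue_le H _ f) => //.
  apply: measurableT_comp (measurable_cap a) _;
    exact: measurable_real_evalue fE.
by move=> x; rewrite cap_ge0 ?cap_le// (real_evalue_ge0 H).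
Qed.

Lemma le_inve_cap a y : (cap a y)%:E <= (a%:E)^-1.
Proof.
rewrite /cap inver; case: ifP => _; first by rewrite leey.
by rewrite lee_fin ge_min lexx orbT.
Qed.

(** Capping a minimizer changes neither its shortfall nor its being an
    e-value. *)
Lemma capped_shortfall_minimizer a h : (0 <= a)%R -> (h <= 1)%R ->
  (0 < a)%R \/ (h < 0)%R ->
  exists f, [/\ real_evalue H f, forall x, (f x)%:E <= (a%:E)^-1,
    \int[mu]_x shortfall a h (f x) < +oo &
    forall g, real_evalue H g ->
      \int[mu]_x shortfall a h (f x) <= \int[mu]_x shortfall a h (g x)].
Proof.
move=> a0 h1 ah; have lV := loss_shortfall a h a0 h1 ah.
have [f [fE Vf fmin]] := loss_minimizer H mu _ mu_fin mu_null lV.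
exists (fun x => cap a (f x)); split.
- exact: real_evalue_cap.
- by move=> x; exact: le_inve_cap.
- by under eq_integral do rewrite shortfall_cap.
- by under eq_integral do rewrite shortfall_cap.
Qed.

Lemma ae_fin_integral (v : X -> \bar R) : measurable_fun [set: X] v ->
  (forall x, 0 <= v x) -> \int[mu]_x v x < +oo ->
  {ae mu, forall x, v x \is a fin_num}.
Proof.
move=> mv v0 Iv.
have iv : mu.-integrable setT v.
  by apply/integrableP; split => //; under eq_integral do rewrite gee0_abs//.
by apply: filterS (integrable_ae measurableT iv) => x; exact.
Qed.

Lemma measurable_loss_comp (V : R -> \bar R) f : loss V -> real_evalue H f ->
  measurable_fun [set: X] (fun x => V (f x)).
Proof.
move=> lV fE; apply: measurableT_comp (measurable_loss _ lV) _.
exact: measurable_real_evalue fE.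
Qed.

Lemma loss_comp_ge0 (V : R -> \bar R) f x : loss V -> real_evalue H f ->
  0 <= V (f x).
Proof. by move=> lV fE; apply: loss_ge0 => //; exact: real_evalue_ge0 fE. Qed.

(** The utilities of [f] and [e'] differ by the shortfall of [e'] minus that of
    [f]; the latter is integrable, whereas the former may have an infinite
    integral. *)
Lemma U_optimal_of_minimizer a h f : (0 <= a)%R -> (h <= 1)%R ->
  (0 < a)%R \/ (h < 0)%R -> real_evalue H f ->
  \int[mu]_x shortfall a h (f x) < +oo ->
  (forall g, real_evalue H g ->
      \int[mu]_x shortfall a h (f x) <= \int[mu]_x shortfall a h (g x)) ->
  U_optimal H mu (capped_power_utility a h) (EFin \o f).
Proof.
move=> a0 h1 ah fE Vf fmin; split => // e' e'E.
have lV := loss_shortfall a h a0 h1 ah.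
have [c cE cle] := capped_power_utility_sup a h a0 h1 ah.
have gE := real_evalue_fine H e' e'E.
have mV := measurable_loss_comp _ _ lV.
have aef := ae_fin_integral _ (mV _ fE) (fun x => loss_comp_ge0 _ f x lV fE) Vf.
have mfV : measurable_fun setT (fun x => fine (shortfall a h (f x))).
  by apply: measurableT_comp => //; exact: mV.
have IfV : \int[mu]_x (fine (shortfall a h (f x)))%:E =
    \int[mu]_x shortfall a h (f x).
  apply: ae_eq_integral => //.
  - exact/measurable_EFinP.
  - exact: mV.
  - by apply: filterS aef => x fx _; rewrite fineK.
have mU := measurable_capped_power_utility a h.
apply: (@expectation_sub_ge0_ae _ _ _ _ _ _
    (fun x => shortfall a h (fine (e' x)))
    (fun x => fine (shortfall a h (f x)))) => //.
- by apply: measurableT_comp => //; case: fE.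
- by apply: measurableT_comp => //; case: e'E.
- exact: mV gE.
- by move=> x; apply: fine_ge0; exact: loss_comp_ge0 lV fE.
- by move=> x; apply: loss_comp_ge0 lV gE.
- apply: filterS2 aef (evalue_ae_fin H mu e' mu_null e'E) => x fx e'x /=.
  rewrite EFinN (fineK fx).
  have y0 := real_evalue_ge0 _ _ x gE; rewrite /= in y0.
  have yE : e' x = (fine (e' x))%:E by rewrite fineK.
  set y := fine (e' x) in y0 yE *; rewrite yE.
  move: fx; rewrite /shortfall cE.
  have := cle (f x) (real_evalue_ge0 _ _ x fE).
  have := cle _ y0.
  case: (capped_power_utility a h y%:E) => [u| |]//= _;
  case: (capped_power_utility a h (f x)%:E) => [v| |]//= _ _; split => //.
  by rewrite -!EFinB; congr EFin; lra.
- by rewrite IfV.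
- rewrite IfV; exact: fmin.
Qed.

End capped.

(** * Logarithmic utility without a cap *)

Section numeraire.
Context {R : realType} {d : measure_display} {X : measurableType d}.
Context (H : set (probability X R)) (mu : {measure set X -> \bar R}).
Hypothesis mu_fin : mu [set: X] < +oo.
Hypothesis mu_null : forall N, null_event H N -> mu N = 0.
Implicit Types (f g : X -> R) (a h : R).

Let M := fine (mu [set: X]).

Let ME : mu [set: X] = M%:E.
Proof. by rewrite fineK// ge0_fin_numE. Qed.

Let M0 : (0 <= M)%R.
Proof. exact: fine_ge0. Qed.

Lemma ae_gt0_of_finite_loss (V : R -> \bar R) f : loss V -> V 0%R = +oo ->
  real_evalue H f -> \int[mu]_x V (f x) < +oo -> {ae mu, forall x, (0 < f x)%R}.
Proof.
move=> lV V0 fE Vf.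
have := ae_fin_integral mu _ (measurable_loss_comp H _ _ lV fE)
  (fun x => loss_comp_ge0 H _ f x lV fE) Vf.
apply: filterS => x fx; rewrite lt0r (real_evalue_ge0 H)// andbT.
by apply/eqP => f0; move: fx; rewrite f0 V0.
Qed.

Lemma shortfall_ln a y : (0 < a)%R -> (0 < y <= a^-1)%R ->
  shortfall a 0 y = (ln a^-1 - ln y)%:E.
Proof.
move=> a0 /andP[y0 ya].
rewrite /shortfall capped_power_utilityE /cap gt_eqF// min_l//.
rewrite /capped_power_utility inver gt_eqF// min_r ?leey//.
by rewrite /power_utility eqxx !lne_EFin ?invr_gt0.
Qed.

Lemma shortfall_ln0 a : (0 < a)%R -> shortfall a 0 0 = +oo :> \bar R.
Proof.
move=> a0; rewrite /shortfall capped_power_utilityE /cap gt_eqF// min_l;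
  last first.
  by rewrite invr_ge0 ltW.
rewrite power_utility0// /capped_power_utility inver gt_eqF// min_r ?leey//.
by rewrite /power_utility eqxx lne_EFin ?invr_gt0.
Qed.

(** The first-order condition for a minimizer [f] of the logarithmic shortfall,
    obtained by moving from [f] towards another e-value [g] below the cap. The
    difference quotient is bounded below by [q t - 2], where [q t >= 0] for
    [t <= 1 / 2], so that Fatou's lemma applies as [t] tends to [0]. *)
Section variation.
Variables (a : R) (f g : X -> R).
Hypotheses (a0 : (0 < a)%R) (fE : real_evalue H f) (gE : real_evalue H g).
Hypotheses (fa : forall x, (f x <= a^-1)%R) (ga : forall x, (g x <= a^-1)%R).
Hypothesis Vf : \int[mu]_x shortfall a 0 (f x) < +oo.
Hypothesis fmin : forall g, real_evalue H g ->
      \int[mu]_x shortfall a 0 (f x) <= \int[mu]_x shortfall a 0 (g x).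

Let ft (t : R) x := ((1 - t) * f x + t * g x)%R.
Let q (t : R) x := (2 + (g x - f x) / ft t x)%R.

Let f0 x : (0 <= f x)%R. Proof. exact: real_evalue_ge0 fE. Qed.
Let g0 x : (0 <= g x)%R. Proof. exact: real_evalue_ge0 gE. Qed.
Let mf := measurable_real_evalue _ _ fE.
Let mg := measurable_real_evalue _ _ gE.

Let ftE t : (0 <= t <= 1)%R -> real_evalue H (ft t).
Proof. by move=> t01; exact: real_evalue_mix. Qed.

Let mq t : (0 <= t <= 1)%R -> measurable_fun [set: X] (q t).
Proof.
move=> t01; apply: measurable_funD => //; apply: measurable_funM.
  exact: measurable_funB.
apply: (measurableT_comp measurable_invr).
exact: measurable_real_evalue (ftE _ t01).
Qed.

Let q_ge0 t x : (0 <= t <= 2^-1)%R -> (0 <= q t x)%R.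
Proof.
move=> /andP[t0 t1]; rewrite /q.
(* Where [ft] vanishes, the quotient is [0] by convention. *)
have [ftx0|ftn0] := eqVneq (ft t x) 0%R; first by rewrite ftx0 invr0 mulr0
  addr0.
have ftp : (0 < ft t x)%R.
  rewrite lt0r ftn0 /ft addr_ge0// mulr_ge0//; lra.
have -> : (2 + (g x - f x) / ft t x = (2 * ft t x + (g x - f x)) / ft t x)%R.
  by field.
rewrite divr_ge0 ?(ltW ftp)// /ft; have := f0 x; have := g0 x; nra.
Qed.

(** From [log(f / ft) <= f / ft - 1 = - t (g - f) / ft] and the minimality of
    [f], after division by [t]. *)
Let q_int t : (0 < t <= 2^-1)%R -> \int[mu]_x (q t x)%:E <= (2 * M)%:E.
Proof.
move=> /andP[t0 t1].
have t01 : (0 <= t <= 1)%R by lra.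
have lV : loss (shortfall a 0).
  by apply: loss_shortfall; [exact: ltW|exact: ler01|left].
have mV k : real_evalue H k ->
    measurable_fun setT (fun x => shortfall a 0 (k x)).
  by move=> kE; exact: (measurable_loss_comp H).
have V0 k x : real_evalue H k -> 0 <= shortfall a 0 (k x).
  by move=> kE; exact: (loss_comp_ge0 H _ k x).
have mEq : measurable_fun setT (fun x => (q t x)%:E).
  exact/measurable_EFinP/mq.
have q0 x : 0 <= (q t x)%:E by rewrite lee_fin q_ge0//; lra.
have key : \int[mu]_x (shortfall a 0 (ft t x) + t%:E * (q t x)%:E) <=
    \int[mu]_x (shortfall a 0 (f x) + (2 * t)%:E).
  apply: ae_ge0_le_integral => //.
  - by move=> x _; apply: adde_ge0; [exact: V0 (ftE _ t01)|rewrite mule_ge0//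
      lee_fin ltW].
  - by apply: emeasurable_funD; [exact: mV (ftE _ t01)|exact: measurable_funeM].
  - by move=> x _; apply: adde_ge0; [exact: V0 fE|rewrite lee_fin; lra].
  - by apply: emeasurable_funD; [exact: mV fE|].
  have := ae_gt0_of_finite_loss _ _ lV (shortfall_ln0 a a0) fE Vf.
  apply: filterS => x fx _.
  have ftp : (0 < ft t x)%R by rewrite /ft; have := g0 x; nra.
  have fta : (ft t x <= a^-1)%R by rewrite /ft; have := fa x; have := ga x; nra.
  rewrite !shortfall_ln ?fx ?ftp ?fa ?fta//.
  rewrite -EFinM -!EFinD lee_fin.
  have r0 := divr_gt0 fx ftp.
  have : (ln (f x) - ln (ft t x) <= f x / ft t x - 1)%R.
    have := @le_ln1Dx R (f x / ft t x - 1)%R; rewrite addrCA subrr addr0.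
    by rewrite ln_div ?posrE//; apply; lra.
  have -> : (f x / ft t x - 1 = - (t * ((g x - f x) / ft t x)))%R.
    rewrite /ft; field; rewrite -/(ft t x) ?gt_eqF//.
  rewrite /q; lra.
move: key.
rewrite ge0_integralD//; last 4 first.
- by move=> x _; exact: V0 (ftE _ t01).
- exact: mV (ftE _ t01).
- by move=> x _; rewrite mule_ge0// lee_fin ltW.
- exact: measurable_funeM.
rewrite ge0_integralD//; last 3 first.
- by move=> x _; exact: V0 fE.
- exact: mV fE.
- by move=> x _; rewrite lee_fin; lra.
rewrite integral_cst// ME ge0_integralZl_EFin//; last exact: ltW.
have If0 : 0 <= \int[mu]_x shortfall a 0 (f x).
  by apply: integral_ge0 => x _; exact: V0 fE.
have Ifin : \int[mu]_x shortfall a 0 (f x) \is a fin_num.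
  by rewrite ge0_fin_numE.
move=> key.
have key2 : \int[mu]_x shortfall a 0 (f x) + t%:E * \int[mu]_x (q t x)%:E <=
    \int[mu]_x shortfall a 0 (f x) + (2 * t)%:E * M%:E.
  by apply: le_trans key; apply: leeD2r; apply: fmin; exact: ftE.
move: key2; rewrite (leeD2lE _ _ Ifin).
have -> : (2 * t)%:E * M%:E = t%:E * (2 * M)%:E.
  by rewrite -!EFinM; congr (_%:E); ring.
by rewrite lee_pmul2l.
Qed.

(** As [t] tends to [0], [q t] tends to [1 + g / f] wherever [f > 0], and
    [f > 0] almost everywhere since the logarithmic shortfall is infinite at
    [0]. *)
Lemma first_order_condition : \int[mu]_x ((g x)%:E * ((f x)%:E)^-1) <= M%:E.
Proof.
(* Starting at [1 / 2], in the range where [q] is nonnegative. *)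
pose t n : R := (n.+2%:R^-1)%R.
have t01 n : (0 < t n <= 2^-1)%R.
  by rewrite /t invr_gt0 ltr0n//= lef_pV2 ?posrE// ler_nat.
have tcv : t n @[n --> \oo] --> (0 : R)%R.
  rewrite (_ : t = fun n => (n + 1)%N.+1%:R^-1)%R; last by apply/funext => n;
    rewrite addn1.
  by rewrite (cvg_shiftn 1 (fun n => n.+1%:R^-1 : R)%R); exact: cvg_harmonic.
have lI := @loss_inv R.
have mgf : measurable_fun setT (fun x => (g x)%:E * ((f x)%:E)^-1).
  apply: emeasurable_funM; first exact/measurable_EFinP.
  exact: (measurable_loss_comp H _ _ lI fE).
have gf0 x : 0 <= (g x)%:E * ((f x)%:E)^-1.
  by apply: mule_ge0; [rewrite lee_fin|exact: (loss_comp_ge0 H _ f x lI fE)].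
have mQ n : measurable_fun setT (fun x => (q (t n) x)%:E).
  by apply/measurable_EFinP/mq; have := t01 n; lra.
have lV : loss (shortfall a 0).
  by apply: loss_shortfall; [exact: ltW|exact: ler01|left].
have Q0 n x : 0 <= (q (t n) x)%:E.
  by rewrite lee_fin q_ge0//; have := t01 n; lra.
have : \int[mu]_x (1 + (g x)%:E * ((f x)%:E)^-1) <= (2 * M)%:E.
  apply: (@le_trans _ _ (\int[mu]_x limn_einf (fun n => (q (t n) x)%:E))).
    apply: ae_ge0_le_integral => //.
    - by move=> x _; apply: adde_ge0.
    - exact: emeasurable_funD.
    - move=> x _; apply: limn_einf_ge => s s0; apply: nearW => n.
      exact: le_trans (ltW s0) _.
    - exact: (@measurable_limn_einf _ _ _ (fun n x => (q (t n) x)%:E)).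
    have := ae_gt0_of_finite_loss _ _ lV (shortfall_ln0 a a0) fE Vf.
    apply: filterS => x fx _.
    have cq : q (t n) x @[n --> \oo] --> (1 + g x / f x)%R.
      have -> : (1 + g x / f x = 2 + (g x - f x) / f x)%R by field;
        rewrite gt_eqF.
      apply: cvgD; first exact: cvg_cst.
      apply: cvgM; first exact: cvg_cst.
      apply: cvgV; first by rewrite gt_eqF.
      have -> : f x = ((1 - 0) * f x + 0 * g x)%R by ring.
      apply: cvgD; apply: cvgM; [|exact: cvg_cst|exact: tcv|exact: cvg_cst].
      by apply: cvgB; [exact: cvg_cst|exact: tcv].
    rewrite (_ : limn_einf _ = (1 + g x / f x)%:E).
      by rewrite inver gt_eqF// -EFinM -EFinD.
    by apply: (cvg_limn_einf_sup _).1; apply: cvg_EFin => //; exact: nearW.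
  apply: le_trans (fatou _ _ _ _) _ => //.
  by apply: limn_einf_le => n; exact: q_int.
rewrite ge0_integralD// integral_cst// mul1e ME.
have -> : (2 * M)%:E = M%:E + M%:E by rewrite -EFinD; congr (_%:E); ring.
by rewrite leeD2lE.
Qed.

End variation.

(** The set [C k] imposes the numeraire inequality against e-values bounded by
    [k + 1]; the log-optimal e-value with cap [n + 1] is in [C k] for [k <= n].
    Truncating an arbitrary [g] at [n + 1] then removes the bound. *)
Lemma numeraire_exists : exists2 f, real_evalue H f &
  forall g, real_evalue H g -> \int[mu]_x ((g x)%:E * ((f x)%:E)^-1) <= M%:E.
Proof.
have lI := @loss_inv R.
pose C (k : nat) := [set f | real_evalue H f /\ forall g, real_evalue H g ->
  (forall x, (g x <= k.+1%:R)%R) ->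
    \int[mu]_x ((g x)%:E * ((f x)%:E)^-1) <= M%:E].
have [|n|f fC] := countable_compactness H mu mu_fin mu_null C.
- move=> k; split => [f []//|f f' [fE fI] [f'E f'I]|u f uC fE uf]; split => //.
  + exact: real_evalue_midpoint.
  + move=> g gE gk; have mg := measurable_real_evalue _ _ gE.
    have g0 x := real_evalue_ge0 _ _ x gE.
    have [_ mid _] := sublevel_convex_closed H mu _ g M lI mg g0.
    have [|//|_ //] := mid f f'; first by split => //; exact: fI.
    by split => //; exact: f'I.
  + move=> g gE gk; have mg := measurable_real_evalue _ _ gE.
    have g0 x := real_evalue_ge0 _ _ x gE.
    have [_ _ clo] := sublevel_convex_closed H mu _ g M lI mg g0.
    have [|//|//|_ //] := clo u f; move=> n.
    by case: (uC n) => uE uI; split => //; exact: uI.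
- have a0 : (0 < (n.+1%:R^-1 : R))%R by rewrite invr_gt0.
  have [f [fE fa Vf fmin]] := capped_shortfall_minimizer H mu mu_fin mu_null
    _ 0%R (ltW a0) ler01 (or_introl a0).
  exists f => k kn; split => // g gE gk.
  have fa' x : (f x <= n.+1%:R^-1^-1)%R.
    by have := fa x; rewrite inver gt_eqF// lee_fin.
  apply: (first_order_condition _ f g a0 fE gE fa' _ Vf fmin) => x.
  by rewrite invrK (le_trans (gk x))// ler_nat.
exists f; first by case: (fC 0%N).
move=> g gE; have fE : real_evalue H f by case: (fC 0%N).
pose gn (n : nat) x := Num.min (g x) n.+1%:R.
have gnE n : real_evalue H (gn n).
  apply: (real_evalue_le H _ g) => //.
    apply: measurable_minr => //; exact: measurable_real_evalue gE.
  by move=> x; rewrite ge_min lexx le_min (real_evalue_ge0 _ _ x gE) ler0n.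
have mW k : real_evalue H k ->
    measurable_fun setT (fun x => (k x)%:E * ((f x)%:E)^-1).
  move=> kE; apply: emeasurable_funM; first by case: kE.
  exact: (measurable_loss_comp H _ _ lI fE).
have W0 k x : real_evalue H k -> 0 <= (k x)%:E * ((f x)%:E)^-1.
  move=> kE; apply: mule_ge0; last exact: (loss_comp_ge0 H _ f x lI fE).
  by rewrite lee_fin (real_evalue_ge0 H).
apply: (@le_trans _ _
  (\int[mu]_x limn_einf (fun n => (gn n x)%:E * ((f x)%:E)^-1))).
  apply: ge0_le_integral => //.
  - by move=> x _; exact: W0.
  - exact: mW.
  - by apply: (@measurable_limn_einf _ _ _
      (fun n x => (gn n x)%:E * ((f x)%:E)^-1)) => n; exact: mW.
  move=> x _; apply: limn_einf_ge => s /ltW sl.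
  have : \forall n \near \oo, (g x <= n.+1%:R)%R.
    near=> n; apply: (@le_trans _ _ n%:R); last by rewrite ler_nat.
    by near: n; exact: nbhs_infty_ger.
  by apply: filterS => n gxn; rewrite /gn min_l.
apply: le_trans (fatou _ _ _ _) _ => //.
- by move=> n; exact: mW.
- by move=> n x _; exact: W0.
- apply: limn_einf_le => n; case: (fC n) => _; apply => // x.
  by rewrite ge_min lexx orbT.
Unshelve. all: by end_near. Qed.

(** With [r = g / f], the difference [log f - log g = - log r] is split as
    [(r - log r) - r]: the first term is at least [1] and the second has
    integral at most the total mass of [mu]. *)
Lemma log_optimal_exists :
  exists f, U_optimal H mu (capped_power_utility 0 0) (EFin \o f).
Proof.
have lI := @loss_inv R.
have [f fE fN] := numeraire_exists; exists f; split => // e' e'E.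
have gE := real_evalue_fine H e' e'E; set g := fine \o e' in gE.
have f0 x := real_evalue_ge0 _ _ x fE; have g0 x := real_evalue_ge0 _ _ x gE.
have mf := measurable_real_evalue _ _ fE;
  have mg := measurable_real_evalue _ _ gE.
have aef : {ae mu, forall x, (0 < f x)%R}.
  apply: (ae_gt0_of_finite_loss _ _ lI _ fE); first by rewrite inve0.
  apply: le_lt_trans (ltry M); have := fN _ (real_evalue_cst1 H).
  by under eq_integral do rewrite mul1e.
pose r x := (g x / f x)%R.
have mr : measurable_fun setT r.
  by apply: measurable_funM => //; exact: (measurableT_comp measurable_invr).
have r0 x : (0 <= r x)%R by rewrite divr_ge0.
have Ir : \int[mu]_x (r x)%:E <= M%:E.
  apply: le_trans (fN _ gE); apply: ge0_le_integral => //.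
  - by move=> x _; rewrite lee_fin.
  - exact/measurable_EFinP.
  - apply: emeasurable_funM; first by case: gE.
    exact: (measurable_loss_comp H _ _ lI fE).
  move=> x _; rewrite /r inver; case: eqVneq => [->|fn0]; last by rewrite EFinM.
  by rewrite invr0 mulr0 mule_ge0// lee_fin.
have mB : measurable_fun setT (fun x => (r x)%:E - lne (r x)%:E).
  apply: emeasurable_funB; first exact/measurable_EFinP.
  by apply: measurableT_comp; [exact: measurable_lne|exact/measurable_EFinP].
have B1 x : 1 <= (r x)%:E - lne (r x)%:E.
  have [->|rn0] := eqVneq (r x) 0%R; first by rewrite le0_lneNy//= leey.
  have rp : (0 < r x)%R by rewrite lt0r rn0 r0.
  rewrite lne_EFin// -EFinB lee_fin.
  have := @le_ln1Dx R (r x - 1)%R; rewrite addrCA subrr addr0; lra.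
have mU := measurable_capped_power_utility (0 : R) 0%R.
apply: (@expectation_sub_ge0_ae _ _ _ _ _ _ (fun x => (r x)%:E - lne (r x)%:E)
  r) => //.
- by apply: measurableT_comp => //; case: fE.
- by apply: measurableT_comp => //; case: e'E.
- by move=> x; apply: le_trans (B1 x); rewrite lee_fin.
- apply: filterS2 aef (evalue_ae_fin H mu e' mu_null e'E) => x fx e'x.
  have yE : e' x = (g x)%:E by rewrite /g /= fineK.
  rewrite /= yE !capped_power_utilityE /cap eqxx /power_utility eqxx lne_EFin//.
  have [gx0|gn0] := eqVneq (g x) 0%R.
    by rewrite /r gx0 mul0r le0_lneNy ?lexx.
  have gx : (0 < g x)%R by rewrite lt0r gn0 g0.
  rewrite /r !lne_EFin ?divr_gt0// ln_div ?posrE//; split => //.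
  rewrite leNgt divr_gt0//=.
  by rewrite -!EFinD; congr (_%:E); ring.
- exact: le_lt_trans Ir (ltry _).
- apply: (le_trans Ir); rewrite -ME -[leLHS]mul1e.
  rewrite -(integral_cst mu measurableT 1).
  by apply: ge0_le_integral => // x _; apply: le_trans (B1 x); rewrite lee_fin.
Qed.

End numeraire.

(** * Power utilities without a cap *)

Section power.
Context {R : realType} {d : measure_display} {X : measurableType d}.
Context (H : set (probability X R)) (mu : {measure set X -> \bar R}).
Hypothesis mu_fin : mu [set: X] < +oo.
Hypothesis mu_null : forall N, null_event H N -> mu N = 0.
Implicit Types (f g : X -> R) (h K : R).

Let M := fine (mu [set: X]).

Let ME : mu [set: X] = M%:E.
Proof. by rewrite fineK// ge0_fin_numE. Qed.

Lemma measurable_powR_comp h f : measurable_fun [set: X] f ->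
  measurable_fun [set: X] (fun x => (f x `^ h)%:E).
Proof.
move=> mf; apply/measurable_EFinP.
exact: (measurableT_comp (measurable_powR h)).
Qed.

Lemma epow_EFin h y : (0 < h)%R -> epow h y%:E = (y `^ h)%:E :> \bar R.
Proof. by move=> h0; rewrite /epow ltNge (ltW h0). Qed.

(** The tail conditions are stated for [power_improvements], whose membership
    follows from a mere comparison of integrals once that of [e0 ^ h] is
    finite. *)
Lemma power_improvement_fine h e0 f : (0 < h)%R -> evalues H e0 ->
  \int[mu]_x epow h (e0 x) < +oo -> real_evalue H f ->
  \int[mu]_x (fine (e0 x) `^ h)%:E <= \int[mu]_x (f x `^ h)%:E ->
  power_improvements H mu h e0 (EFin \o f).
Proof.
move=> h0 e0E Ie0 fE le; split => //.
have gE := real_evalue_fine H e0 e0E; set g := fine \o e0 in gE.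
have mg := measurable_real_evalue _ _ gE;
  have mf := measurable_real_evalue _ _ fE.
have aeg := evalue_ae_fin H mu e0 mu_null e0E.
have mE : measurable_fun setT (fun x => epow h (e0 x)).
  by apply: (measurableT_comp (measurable_epow h)); case: e0E.
apply: (@expectation_sub_ge0_ae _ _ _ _ _ _ (fun x => (f x `^ h)%:E)
    (fun x => g x `^ h)%R) => //.
- by apply: (measurableT_comp (measurable_epow h)); case: fE.
- exact: (measurableT_comp (measurable_powR h)).
- exact: measurable_powR_comp.
- by move=> x; rewrite powR_ge0.
- by move=> x; rewrite lee_fin powR_ge0.
- apply: filterS aeg => x e0x; have yE : e0 x = (g x)%:E by rewrite /g /= fineK.
  by rewrite /= yE !epow_EFin.
apply: le_lt_trans Ie0; rewrite le_eqVlt; apply/orP; left; apply/eqP.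
apply: ae_eq_integral => //; first exact: measurable_powR_comp.
by apply: filterS aeg => x e0x _; rewrite -epow_EFin// /g /= fineK.
Qed.

(** In terms of the shortfall with cap [K], a lower bound on the integral of
    [min(f, K)^h] becomes an upper bound on the integral of a loss. *)
Lemma shortfall_pow h K y : (0 < h <= 1)%R -> (0 < K)%R -> (0 <= y)%R ->
  h%:E * shortfall K^-1 h y = (K `^ h - Num.min y K `^ h)%:E.
Proof.
move=> /andP[h0 h1] K0 y0.
rewrite /shortfall capped_power_utilityE /cap invr_eq0 gt_eqF// invrK.
rewrite /capped_power_utility inver invr_eq0 gt_eqF// invrK min_r ?leey//.
rewrite !power_utilityE ?le_min ?y0 ?(ltW K0)//; [|by right|by right].
rewrite /real_utility gt_eqF// -EFinB -EFinM; congr (_%:E); field;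
  rewrite gt_eqF//.
Qed.

Section maximizer.
Variables (h : R) (g0 : X -> R).
Hypotheses (h01 : (0 < h <= 1)%R) (g0E : real_evalue H g0).
Hypothesis tail : forall eta : R, (0 < eta)%R -> exists2 K : R, (0 < K)%R &
  forall f, real_evalue H f ->
    \int[mu]_x (g0 x `^ h)%:E <= \int[mu]_x (f x `^ h)%:E ->
    \int[mu]_x (f x `^ h)%:E <= \int[mu]_x (Num.min (f x) K `^ h)%:E + eta%:E.

Let h_gt0 : (0 < h)%R. Proof. by case/andP: h01. Qed.

Let P f := \int[mu]_x (f x `^ h)%:E.
Let T f K := \int[mu]_x (Num.min (f x) K `^ h)%:E.

Let P0 f : 0 <= P f.
Proof. by apply: integral_ge0 => x _; rewrite lee_fin powR_ge0. Qed.

Let T0 f K : 0 <= T f K.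
Proof. by apply: integral_ge0 => x _; rewrite lee_fin powR_ge0. Qed.

Let mmin f K : real_evalue H f ->
  measurable_fun [set: X] (fun x => Num.min (f x) K).
Proof.
by move=> fE; apply: measurable_minr => //; exact: measurable_real_evalue fE.
Qed.

Let T_le f K : real_evalue H f -> (0 < K)%R -> T f K <= (K `^ h * M)%:E.
Proof.
move=> fE K0; have h0 := ltW h_gt0.
rewrite EFinM -ME -(integral_cst mu measurableT).
apply: ge0_le_integral => //.
- by move=> x _; rewrite lee_fin powR_ge0.
- exact/measurable_powR_comp/mmin.
move=> x _; rewrite lee_fin ge0_ler_powR ?nnegrE ?le_min ?(real_evalue_ge0 _ _
  x fE) ?(ltW K0)//.
by rewrite ge_min lexx orbT.
Qed.

Let TP f K : real_evalue H f -> (0 < K)%R -> T f K <= P f.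
Proof.
move=> fE K0; have h0 := ltW h_gt0.
apply: ge0_le_integral => //.
- by move=> x _; rewrite lee_fin powR_ge0.
- exact/measurable_powR_comp/mmin.
- exact: measurable_powR_comp (measurable_real_evalue _ _ fE).
move=> x _; rewrite lee_fin ge0_ler_powR ?nnegrE ?le_min ?(real_evalue_ge0 _ _
  x fE) ?(ltW K0)//.
by rewrite ge_min lexx.
Qed.

Let shortfall_int f K : real_evalue H f -> (0 < K)%R ->
  \int[mu]_x (h%:E * shortfall K^-1 h (f x)) + T f K = (K `^ h * M)%:E.
Proof.
move=> fE K0; have h0 := ltW h_gt0.
have E x : h%:E * shortfall K^-1 h (f x) = (K `^ h - Num.min (f x) K `^ h)%:E.
  by apply: shortfall_pow => //; exact: real_evalue_ge0 fE.
under eq_integral do rewrite E.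
rewrite -ge0_integralD//; last 4 first.
- move=> x _; rewrite lee_fin subr_ge0 ge0_ler_powR ?nnegrE ?le_min
    ?(real_evalue_ge0 _ _ x fE) ?(ltW K0)//.
  by rewrite ge_min lexx orbT.
- under eq_fun do rewrite EFinB.
  by apply: emeasurable_funB => //; exact/measurable_powR_comp/mmin.
- by move=> x _; rewrite lee_fin powR_ge0.
- exact/measurable_powR_comp/mmin.
under eq_integral do rewrite -EFinD subrK.
by rewrite integral_cst// ME EFinM.
Qed.

(** Upper semicontinuity of [P] fails in general; the tail condition restores
    it by making [P f] and [T f K] uniformly close on [G], where the supremum
    [S] is approached. The set [C k] is [T f (Kk k) >= S - 2 c_k]: one [c_k]
    accounts for the tail, the other for the approximation of the supremum. *)
Lemma power_maximizer : exists f, [/\ real_evalue H f, P f < +oo &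
  forall g, real_evalue H g -> P g <= P f].
Proof.
pose G := [set f | real_evalue H f /\ P g0 <= P f].
pose S := ereal_sup [set P f | f in G].
have Gg0 : G g0 by split.
have Pg0S : P g0 <= S by apply: ereal_sup_ubound; exists g0.
have Sub f : real_evalue H f -> P f <= S.
  move=> fE; have [le|/ltW lt] := leP (P g0) (P f); last exact: le_trans lt _.
  by apply: ereal_sup_ubound; exists f; [split|reflexivity].
have S0 : 0 <= S by exact: le_trans Pg0S.
have Sfin : S \is a fin_num.
  have [K K0 HK] := tail _ (ltr01 : (0 < 1 :> R)%R).
  rewrite ge0_fin_numE//; apply: (@le_lt_trans _ _ (K `^ h * M + 1)%:E);
    last exact: ltry.
  apply: ge_ereal_sup => _ [f [fE fG] <-]; apply: (le_trans (HK f fE fG)).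
  by rewrite EFinD leeD2r// T_le.
have [s sE] : exists s, S = s%:E by exists (fine S); rewrite fineK.
have [c [c0 cdec csmall]] := @vanishing_sequence R.
have [Kk Kk0 KkP] : exists2 Kk : nat -> R, forall k, (0 < Kk k)%R &
    forall k f, G f -> P f <= T f (Kk k) + (c k)%:E.
  have /choice[Kk KkP] (k : nat) : exists K, (0 < K)%R /\
      forall f, G f -> P f <= T f K + (c k)%:E.
    by have [K K0 HK] := tail _ (c0 k); exists K; split => // f [fE]; exact: HK.
  by exists Kk => k; case: (KkP k).
pose C k := [set f | real_evalue H f /\
  \int[mu]_x (h%:E * shortfall (Kk k)^-1 h (f x)) <=
    (Kk k `^ h * M - (s - 2 * c k))%:E].
have CP k f : C k f <-> real_evalue H f /\ (s - 2 * c k)%:E <= T f (Kk k).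
  split=> -[fE fI]; split => //; move: fI;
    have := shortfall_int f (Kk k) fE (Kk0 k).
    have := T_le f (Kk k) fE (Kk0 k); have := T0 f (Kk k).
    case: (T f (Kk k)) => [t| |]//= _ _; case: (\int[mu]_x _) => [u| |]//=.
    rewrite -EFinD => -[]; rewrite !lee_fin.
    by move: (Kk k `^ h * M)%R => w; lra.
  have := T_le f (Kk k) fE (Kk0 k); have := T0 f (Kk k).
  case: (T f (Kk k)) => [t| |]//= _ _; case: (\int[mu]_x _) => [u| |]//=.
  rewrite -EFinD => -[]; rewrite !lee_fin.
    by move: (Kk k `^ h * M)%R => w; lra.
have [|n|f fC] := countable_compactness H mu mu_fin mu_null C.
- move=> k; apply: (sublevel_convex_closed H mu _ (fun=> h)) => //.
    have k0 := Kk0 k; apply: loss_shortfall; [|by case/andP: h01|by left;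
      rewrite invr_gt0].
    by rewrite invr_ge0 ltW.
  by move=> _; exact: ltW.
- have [_ [f fG <-] If] := ub_ereal_sup_adherent (c0 n) Sfin.
  exists f => k kn; apply/CP; split; first by case: fG.
  have [p pE] : exists p, P f = p%:E.
    exists (fine (P f)); rewrite fineK// ge0_fin_numE//.
    by apply: le_lt_trans (Sub f fG.1) _; rewrite sE ltry.
  have := KkP k f fG; move: If; rewrite -/S sE -/(P f) pE.
  have := T0 f (Kk k); case: (T f (Kk k)) => [t| |]//= _; last by move=> *;
    rewrite leey.
  rewrite -EFinB lte_fin -EFinD !lee_fin.
  by have := cdec _ _ kn; lra.
have fE : real_evalue H f by case: (fC 0%N).
exists f; split; first exact: fE.
- by apply: le_lt_trans (Sub f fE) _; rewrite sE ltry.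
- move=> g gE; apply: le_trans (Sub g gE) _; rewrite sE.
  apply/lee_addgt0Pr => e e0.
  have [k ke] := csmall (e / 2)%R (divr_gt0 e0 (ltr0n _ 2)).
  have [_ sk] := (CP k f).1 (fC k).
  apply: (@le_trans _ _ (T f (Kk k) + e%:E)); last by apply: leeD2r; exact: TP.
  apply: (@le_trans _ _ ((s - 2 * c k)%:E + e%:E)); last exact: leeD2r.
  by rewrite -EFinD lee_fin; lra.
Qed.

End maximizer.

Lemma power_optimal_exists h e0 : (0 < h <= 1)%R -> evalues H e0 ->
  \int[mu]_x epow h (e0 x) < +oo ->
  (forall eta : R, (0 < eta)%R -> exists2 K : R, (0 < K)%R &
    forall f, real_evalue H f -> power_improvements H mu h e0 (EFin \o f) ->
    \int[mu]_x (f x `^ h)%:E <=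
      \int[mu]_x (Num.min (f x) K `^ h)%:E + eta%:E) ->
  exists f, U_optimal H mu (capped_power_utility 0 h) (EFin \o f).
Proof.
move=> h01 e0E Ie0 tail; have /andP[h0 h1] := h01.
have [|f [fE If fmax]] := power_maximizer h (fine \o e0) h01
  (real_evalue_fine H e0 e0E).
  move=> eta eta0; have [K K0 HK] := tail eta eta0; exists K => // f fE fP.
  by apply: HK => //; exact: power_improvement_fine.
exists f; split => // e' e'E.
have gE := real_evalue_fine H e' e'E; set g := fine \o e' in gE.
have mg := measurable_real_evalue _ _ gE;
  have mf := measurable_real_evalue _ _ fE.
have mU := measurable_capped_power_utility (0 : R) h.
have Z k : real_evalue H k -> \int[mu]_x (k x `^ h / h)%:E =
    (h^-1)%:E * \int[mu]_x (k x `^ h)%:E.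
  move=> kE; under eq_integral do rewrite mulrC EFinM.
  rewrite ge0_integralZl_EFin//; last by rewrite invr_ge0 ltW.
  - by move=> x _; rewrite lee_fin powR_ge0.
  - exact: measurable_powR_comp (measurable_real_evalue _ _ kE).
apply: (@expectation_sub_ge0_ae _ _ _ _ _ _ (fun x => (f x `^ h / h)%:E)
    (fun x => g x `^ h / h)%R) => //.
- by apply: measurableT_comp => //; case: fE.
- by apply: measurableT_comp => //; case: e'E.
- apply: measurable_funM => //; exact: (measurableT_comp (measurable_powR h)).
- apply/measurable_EFinP; apply: measurable_funM => //.
  exact: (measurableT_comp (measurable_powR h)).
- by move=> x; rewrite divr_ge0 ?powR_ge0// ltW.
- by move=> x; rewrite lee_fin divr_ge0 ?powR_ge0// ltW.
- apply: filterS (evalue_ae_fin H mu e' mu_null e'E) => x e'x.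
  have yE : e' x = (g x)%:E by rewrite /g /= fineK.
  rewrite /= yE !capped_power_utilityE /cap eqxx !power_utilityE; try by right.
  + by rewrite /real_utility gt_eqF//; split => //; rewrite -!EFinD;
      congr (_%:E); ring.
  + exact: (real_evalue_ge0 _ _ x gE).
  + exact: (real_evalue_ge0 _ _ x fE).
- rewrite (Z g gE); apply: lte_mul_pinfty;
    [by rewrite lee_fin invr_ge0 ltW|by []|].
  exact: le_lt_trans (fmax g gE) If.
- rewrite (Z f fE) (Z g gE); apply: lee_wpmul2l; last exact: fmax.
  by rewrite lee_fin invr_ge0 ltW.
Qed.

End power.

(** * The two sufficient conditions for small tails *)

Section tails.
Context {R : realType} {d : measure_display} {X : measurableType d}.
Context (H : set (probability X R)) (mu : {measure set X -> \bar R}).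
Implicit Types (f : X -> R) (h K : R) (D : set (X -> \bar R)).

Lemma ge0_integral_leD f1 f2 f3 : measurable_fun [set: X] f1 ->
  measurable_fun [set: X] f2 -> measurable_fun [set: X] f3 ->
  (forall x, (0 <= f1 x)%R) -> (forall x, (0 <= f2 x)%R) ->
  (forall x, (0 <= f3 x)%R) ->
  (forall x, (f1 x <= f2 x + f3 x)%R) ->
  \int[mu]_x (f1 x)%:E <= \int[mu]_x (f2 x)%:E + \int[mu]_x (f3 x)%:E.
Proof.
move=> mf1 mf2 mf3 p1 p2 p3 le.
have m1 : measurable_fun setT (fun x => (f1 x)%:E) by exact/measurable_EFinP.
have m2 : measurable_fun setT (fun x => (f2 x)%:E) by exact/measurable_EFinP.
have m3 : measurable_fun setT (fun x => (f3 x)%:E) by exact/measurable_EFinP.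
rewrite -ge0_integralD//; try by move=> x _; rewrite lee_fin.
apply: ge0_le_integral => //.
- by move=> x _; rewrite lee_fin.
- exact: emeasurable_funD.
- by move=> x _; rewrite -EFinD lee_fin.
Qed.

(** Beyond [K], [y^h = y^(h - 1) y], and [y^(h - 1) <= K^(h - 1)] as
    [h <= 1]. *)
Lemma powR_le_trunc h K y : (0 < h <= 1)%R -> (0 < K)%R -> (0 <= y)%R ->
  (y `^ h <= Num.min y K `^ h + K `^ (h - 1) * y)%R.
Proof.
move=> /andP[h0 h1] K0 y0; have Kh : (0 <= K `^ (h - 1) * y)%R.
  by rewrite mulr_ge0// powR_ge0.
have [yK|Ky] := leP y K; first by rewrite lerDl.
have yp := lt_trans K0 Ky.
have -> : (y `^ h = y `^ (h - 1) * y)%R.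
  by rewrite -[X in _ = (_ * X)%R]powRr1// -powRD ?subrK// gt_eqF ?implybT.
have : (y `^ (h - 1) <= K `^ (h - 1))%R.
  rewrite -opprB !powRN lef_pV2 ?posrE ?powR_gt0//.
  by apply: ge0_ler_powR; rewrite ?subr_ge0 ?nnegrE ?(ltW K0) ?(ltW yp)// ltW.
have := powR_ge0 K h; nra.
Qed.

(** If the means are at most [m], the tail is at most [K^(h - 1) m], which
    tends to [0] as [K] grows since [h < 1]; the value of [K] solves
    [K^(h - 1) = eta / m]. *)
Lemma bounded_mean_tail D h : (0 < h < 1)%R ->
  ereal_sup [set \int[mu]_x e x | e in D] < +oo ->
  forall eta : R, (0 < eta)%R -> exists2 K : R, (0 < K)%R &
    forall f, real_evalue H f -> D (EFin \o f) ->
    \int[mu]_x (f x `^ h)%:E <= \int[mu]_x (Num.min (f x) K `^ h)%:E + eta%:E.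
Proof.
move=> /andP[h0 h1] sup_lt eta eta0.
have [m m0 Dm] : exists2 m : R, (0 < m)%R & forall f, D (EFin \o f) ->
    \int[mu]_x (f x)%:E <= m%:E.
  move: sup_lt; set S := ereal_sup _ => sup_lt.
  exists (`|fine S| + 1)%R; first by rewrite ltr_wpDl.
  move=> f Df; have : \int[mu]_x (f x)%:E <= S.
    by apply: ereal_sup_ubound; exists (EFin \o f).
  move: sup_lt; case: S => [s| |]//= _; last first.
    by move=> /le_trans; apply; rewrite leNye.
  by move=> /le_trans; apply; rewrite lee_fin; have := ler_norm s; lra.
have em : (0 < eta / m)%R by rewrite divr_gt0.
have K0 : (0 < (eta / m) `^ (h - 1)^-1)%R by rewrite powR_gt0.
exists ((eta / m) `^ (h - 1)^-1)%R => // f fE Df.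
set K := ((eta / m) `^ (h - 1)^-1)%R in K0 *.
have KE : (K `^ (h - 1) = eta / m)%R.
  by rewrite /K -powRrM mulVf ?powRr1 ?(ltW em)//; apply/eqP; lra.
have mf := measurable_real_evalue _ _ fE; have f0 x := real_evalue_ge0 _ _ x fE.
have mp k : measurable_fun setT k -> measurable_fun setT
    (fun x : X => k x `^ h)%R.
  by move=> mk; exact: (measurableT_comp (measurable_powR h)).
apply: le_trans (ge0_integral_leD _ (fun x => Num.min (f x) K `^ h)%R
  (fun x => K `^ (h - 1) * f x)%R _ _ _ _ _ _ _) _.
- exact: mp.
- by apply: mp; exact: measurable_minr.
- exact: measurable_funM.
- by move=> x; rewrite powR_ge0.
- by move=> x; rewrite powR_ge0.
- by move=> x; rewrite mulr_ge0// powR_ge0.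
- by move=> x; apply: powR_le_trunc => //; lra.
apply: leeD2l; under eq_integral do rewrite EFinM.
rewrite ge0_integralZl_EFin//; last 3 first.
- by move=> x _; rewrite lee_fin.
- exact/measurable_EFinP.
- by rewrite powR_ge0.
rewrite KE; apply: (@le_trans _ _ ((eta / m)%:E * m%:E)).
  by apply: lee_wpmul2l; [rewrite lee_fin ltW|exact: Dm].
by rewrite -EFinM divfK// gt_eqF.
Qed.

Lemma uniformly_integrable_tail D : uniformly_integrable mu D ->
  forall eta : R, (0 < eta)%R -> exists2 K : R, (0 < K)%R &
    forall f, real_evalue H f -> D (EFin \o f) ->
    \int[mu]_x (f x `^ 1)%:E <= \int[mu]_x (Num.min (f x) K `^ 1)%:E + eta%:E.
Proof.
move=> UI eta eta0; have [K KP] := UI eta eta0.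
(* The level [K] given by uniform integrability may be negative. *)
pose K' := Num.max K 1%R; have K'0 : (0 < K')%R by rewrite lt_max ltr01 orbT.
exists K' => // f fE Df.
have mf := measurable_real_evalue _ _ fE; have f0 x := real_evalue_ge0 _ _ x fE.
have mA : measurable [set x | K%:E <= `|(EFin \o f) x| ].
  rewrite (_ : [set x | _] = f @^-1` `[K, +oo[).
    by rewrite -[X in measurable X]setTI; exact: mf.
  apply/seteqP; split => x /=; rewrite in_itv/= andbT lee_fin ger0_norm//.
have mt k : (k = f \_ [set x | K%:E <= `|(EFin \o f) x| ]) ->
    measurable_fun setT k.
  by move=> ->; apply/(measurable_restrictT _ mA); exact: measurable_funS mf.
apply: le_trans (ge0_integral_leD _ (fun x => Num.min (f x) K' `^ 1)%R
  (f \_ [set x | K%:E <= `|(EFin \o f) x| ]) _ _ _ _ _ _ _) _.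
- exact: (measurableT_comp (measurable_powR 1%R)).
- apply: (measurableT_comp (measurable_powR 1%R)); exact: measurable_minr.
- exact: mt.
- by move=> x; rewrite powR_ge0.
- by move=> x; rewrite powR_ge0.
- by move=> x; rewrite patchE; case: ifP.
- move=> x; rewrite !powRr1 ?le_min ?f0 ?(ltW K'0)// patchE; case: ifPn => [_|].
    by rewrite lerDr le_min f0 ltW.
  rewrite notin_setE /= lee_fin ger0_norm// => /negP; rewrite -ltNge => fK.
  by rewrite addr0 min_l// le_max ltW.
apply: leeD2l; apply: le_trans (KP _ Df).
rewrite [leRHS]integral_mkcond; apply: ge0_le_integral => //.
- by move=> x _; rewrite lee_fin patchE; case: ifP.
- exact/measurable_EFinP/mt.
- apply/(measurable_restrictT _ mA); apply: measurableT_comp => //.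
  by apply: measurable_funS (measurableT) _ _ => //; exact/measurable_EFinP.
move=> x _; rewrite !patchE; case: ifP => //= _.
by rewrite ger0_norm.
Qed.

End tails.

Theorem corollary9 (R : realType) (d : measure_display) (X : measurableType d)
    (H : set (probability X R)) (Q : probability X R)
    (Qa Qs : {measure set X -> \bar R})
    (HQ : generalized_lebesgue_decomposition H Q Qa Qs)
    (a h : R) (ha : (0 <= a <= 1)%R) (hh : (h <= 1)%R) :
  [/\ (0 < a)%R \/ (h <= 0)%R ->
        exists2 e : X -> \bar R,
          U_optimal H Qa (capped_power_utility a h) e
          & forall x, 0 <= e x <= (a%:E)^-1,
      a = 0%R -> (0 < h < 1)%R ->
        (exists e0 : X -> \bar R,
          [/\ evalues H e0, \int[Qa]_x epow h (e0 x) < +oo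
            & ereal_sup [set \int[Qa]_x e x
                        | e in power_improvements H Qa h e0] < +oo]) ->
        exists e : X -> \bar R, U_optimal H Qa (capped_power_utility 0 h) e
    & a = 0%R -> h = 1%R ->
        (exists e0 : X -> \bar R,
          [/\ evalues H e0, \int[Qa]_x e0 x < +oo
            & uniformly_integrable Qa (power_improvements H Qa 1 e0)]) ->
        exists e : X -> \bar R, U_optimal H Qa (capped_power_utility 0 1) e].
Proof.
case: HQ => Qdec _ Qa_null.
have Qa_fin : Qa [set: X] < +oo.
  apply: (@le_lt_trans _ _ (Q [set: X]));
    first by rewrite (Qdec _ measurableT) leeDl.
  by rewrite (le_lt_trans (probability_le1 Q measurableT))// ltry.
case/andP: ha => a0 _; split.
- have evalue_bounds (f : X -> R) : real_evalue H f ->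
      (forall x, (f x)%:E <= (a%:E)^-1) -> forall x, 0 <= (f x)%:E <= (a%:E)^-1.
    by move=> fE fa x; rewrite fa lee_fin (real_evalue_ge0 H).
  have [aE|an0] := eqVneq a 0%R; last first.
    have ap : (0 < a)%R by rewrite lt0r an0.
    have ah : (0 < a)%R \/ (h < 0)%R by left.
    have [f [fE fa Vf fmin]] :=
      capped_shortfall_minimizer H Qa Qa_fin Qa_null a h a0 hh ah.
    move=> _; exists (EFin \o f); last exact: evalue_bounds.
    exact: U_optimal_of_minimizer.
  move=> [|h0]; first by rewrite aE ltxx.
  have [hE|hn0] := eqVneq h 0%R.
    have [f fO] := log_optimal_exists H Qa Qa_fin Qa_null.
    exists (EFin \o f); first by rewrite aE hE.
    apply: evalue_bounds; first by case: fO.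
    by move=> x; rewrite aE inve0 leey.
  have ah : (0 < a)%R \/ (h < 0)%R by right; rewrite lt_neqAle hn0.
  have [f [fE fa Vf fmin]] :=
    capped_shortfall_minimizer H Qa Qa_fin Qa_null a h a0 hh ah.
  exists (EFin \o f); last exact: evalue_bounds.
  exact: U_optimal_of_minimizer.
- move=> _ h01 [e0 [e0E Ie0 sup_lt]].
  have h01' : (0 < h <= 1)%R by case/andP: h01 => -> /ltW ->.
  have [f fO] := power_optimal_exists H Qa Qa_fin Qa_null h e0 h01' e0E Ie0
    (bounded_mean_tail H Qa _ h h01 sup_lt).
  by exists (EFin \o f).
- move=> _ _ [e0 [e0E Ie0 UI]].
  have Ie0' : \int[Qa]_x epow 1 (e0 x) < +oo.
    have [_ e0_ge0 _] := e0E.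
    by under eq_integral do rewrite /epow ltNge ler01 poweRe1//.
  have h01 : (0 < (1 : R) <= 1)%R by rewrite ltr01 lexx.
  have [f fO] := power_optimal_exists H Qa Qa_fin Qa_null 1%R e0 h01 e0E Ie0'
    (uniformly_integrable_tail H Qa _ UI).
  by exists (EFin \o f).
Qed.
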